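(* Fix integers $q\ge 0$, $n>0$ and $g\ge 0$ with $2g-q+n\ge 3$. For $\beta=(\beta_1,\ldots,\beta_n)$ a tuple of positive integers let $|\beta|=\beta_1+\cdots+\beta_n$ and $t=2g+n-1-q$. Then the scaled Hurwitz number $\mathsf{H}^g_{|\beta|,|\beta|-q}(\beta)/(t!\,|\beta|)$ is a polynomial in $\beta_1,\ldots,\beta_n$ whose lowest degree is at least $2g+n-2-\delta_{0,q}-q$ and whose highest degree is exactly $4g+n-3$.
   Context: For a partition $\beta=[1^{a_1},\ldots,d^{a_d}]\vdash d$ with $n$ parts (a tuple of positive integers is identified with the partition obtained by sorting it), $\mathrm{Aut}(\beta)=\prod_i a_i!$. For $g\ge 0$, $m>0$ with $t=2g-1+n+m-d\ge 0$, $\mathsf{H}^g_{d,m}(\beta)=\frac{\mathrm{Aut}(\beta)}{d!}N$, where $N$ is the number of tuples $(\sigma_0,\tau_1,\ldots,\tau_t,\sigma_{t+1})$ in $\mathfrak{S}_d$ with $\sigma_0$ a $d$-cycle, each $\tau_i$ a transposition, $\sigma_{t+1}$ of cycle type $\beta$, and $\sigma_0\tau_1\cdots\tau_t\sigma_{t+1}$ having exactly $m$ cycles. Here $d=|\beta|$ and $m=|\beta|-q$. $\delta_{0,q}$ is the Kronecker delta. The lowest (highest) degree of a polynomial is the minimal (maximal) total degree of a monomial with nonzero coefficient. *)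

(* Defs.v *)
From HB Require Import structures.
From mathcomp Require Import all_boot all_order all_algebra all_fingroup.
From mathcomp Require Import mpoly.
Set Implicit Arguments. Unset Strict Implicit. Unset Printing Implicit Defensive.
Import GRing.Theory Num.Theory.

Definition cycle_type (d : nat) (s : 'S_d) : seq nat :=
  sort geq [seq #|C| | C : {set 'I_d} in porbits s].

Definition ncycles (d : nat) (s : 'S_d) : nat := #|porbits s|.

Definition is_transposition (d : nat) (s : 'S_d) : bool :=
  [exists x : 'I_d, exists y : 'I_d, (x != y) && (s == tperm x y)].

Definition autb (b : seq nat) : nat := \prod_(k <- undup b) (count_mem k b)`!.

Definition hurwitzN (d t m : nat) (b : seq nat) : nat :=
  #|[set x : 'S_d * {ffun 'I_t -> 'S_d} * 'S_d |
      [&& cycle_type x.1.1 == [:: d],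
          [forall i, is_transposition (x.1.2 i)],
          cycle_type x.2 == sort geq b &
          ncycles (x.1.1 * (\prod_(i < t) x.1.2 i) * x.2)%g == m]]|.

(* H^g_{d,m}(beta) with d = |beta|, n = number of parts,
   t = 2g - 1 + n + m - d  (meaningful when m > 0 and t >= 0). *)
Definition hurwitz (g m : nat) (b : seq nat) : rat :=
  let d := sumn b in
  let t := (2 * g + size b + m - (d + 1))%N in
  ((autb b)%:R / (d`!)%:R * (hurwitzN d t m b)%:R)%R.

(* Main.v *)
(** Only hook characters survive on a [d]-cycle: with
    [Phi_s(z) = det(1 - z P_s) / (1 - z) = prod_C (1 - z^|C|) / (1 - z)],
    the product being over the cycles of [s], the indicator of the [d]-cycles is
    [Phi_s(1) / d].  The coefficient of [z^k] in [Phi_s] is a sum of bordered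
    principal minors of [P_s], on which the Jucys-Murphy elements act by the
    contents [-k, ..., d-1-k] of a hook.  Hence
    [sum_p y^(d - cyc p) Phi_(s p)] multiplies that coefficient by
    [prod_l (1 + (l - k) y)], and with [w_k = (d-1)/2 - k] and [E_q] the
    coefficient of [y^q] in this product,
    [H = (d prod b_i)^-1 sum_k [z^k]Phi (d w_k)^t E_q(d, k)].

    Summing the recurrence of [E_q] in [d] gives [E_q = (d w)^q/q! + d h] with
    [h] of total degree at most [2q - 2] in [d, w].  The moment
    [(prod b_i)^-1 sum_k [z^k]Phi w_k^s] is obtained by applying the operators
    [b_i^-1 (shift (b_i/2) - shift (-b_i/2))] to an antiderivative of [x^s] for
    the central difference, hence is a polynomial of degree [s + 1 - n]; for
    [s = 2g + n - 1] the power [b_1^(2g)] occurs in it.  All degree statements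
    follow. *)

Require Import Defs.
From HB Require Import structures.
From mathcomp Require Import all_boot all_order all_algebra all_fingroup.
From mathcomp Require Import mpoly.
From mathcomp Require Import zify ring lra.
Import GRing.Theory Num.Theory.

Set Implicit Arguments.
Unset Strict Implicit.
Unset Printing Implicit Defensive.

(** * Inserting a point into a cycle *)

Section Peeling.

Variable T : finType.
Implicit Types (s : {perm T}) (x y : T) (S : {set T}).

Lemma porbit_step s x y : (s y \in porbit s x) = (y \in porbit s x).
Proof.
by rewrite -!eq_porbit_mem (porbit_perm s 1 y).
Qed.

Lemma porbit_min s x S : x \in S -> {in S, forall y, s y \in S} ->
  porbit s x \subset S.
Proof.
move=> xS clS; apply/subsetP=> _ /porbitP[i ->].
by elim: i => [|i IH]; rewrite ?expg0 ?perm1 // expgSr permM clS.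
Qed.

Lemma mul_tpermE s x y z : (s * tperm x y)%g z = tperm x y (s z).
Proof. exact: permM. Qed.

Section Insert.

(* [s * tperm x y] is [s] with the fixed point [x] inserted just before [y]
   in its cycle. *)
Variables (s : {perm T}) (x y : T).
Hypotheses (sx : s x = x) (nxy : y != x).
Let r := (s * tperm x y)%g.

Lemma fix_notin_porbit : x \notin porbit s y.
Proof.
apply/negP; rewrite porbit_sym => /(subsetP (porbit_min (set11 x) _)) h.
have: y \in [set x] by apply: h => z; rewrite !inE => /eqP->; rewrite sx.
by rewrite inE (negPf nxy).
Qed.

Lemma fix_porbit : porbit s x = [set x].
Proof.
apply/eqP; rewrite eqEsubset sub1set porbit_id andbT.
by apply: porbit_min; rewrite ?set11 // => z; rewrite !inE => /eqP->; rewrite sx.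
Qed.

Lemma insertx : r x = y.
Proof. by rewrite mul_tpermE sx tpermL. Qed.

Lemma porbit_insert_in : porbit r x = x |: porbit s y.
Proof.
apply/eqP; rewrite eqEsubset; apply/andP; split.
  apply: porbit_min => [|z]; first by rewrite setU11.
  rewrite !inE mul_tpermE => /orP[/eqP->|zC].
    by rewrite sx tpermL porbit_id orbT.
  by case: tpermP => [_|_|_ _]; rewrite ?porbit_id ?eqxx ?porbit_step ?zC ?orbT.
rewrite subUset sub1set porbit_id /=.
suff clo : {in porbit r x, forall z, s z \in porbit r x}.
  apply: porbit_min => //; by rewrite -insertx porbit_step porbit_id.
move=> z zR; have [->|nszx] := eqVneq (s z) x; first exact: porbit_id.
have [->|nszy] := eqVneq (s z) y; first by rewrite -insertx porbit_step porbit_id.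
by rewrite -(@tpermD _ x y (s z)) 1?eq_sym // -mul_tpermE porbit_step.
Qed.

Lemma porbit_insert_out z : z != x -> z \notin porbit s y ->
  porbit r z = porbit s z.
Proof.
move=> nzx nzC.
have nC u : u \in porbit s z -> u != x /\ u != y.
  move=> uz; split; apply: contraNneq nzC => eu; move: uz; rewrite eu porbit_sym.
    by rewrite fix_porbit inE (negPf nzx).
  by [].
have E i : (r ^+ i)%g z = (s ^+ i)%g z.
  elim: i => [|i IH]; first by rewrite !expg0.
  rewrite !expgSr !permM IH.
  have [h1 h2] := nC _ (mem_porbit s i.+1 z).
  by move: h1 h2; rewrite expgSr permM => h1 h2; rewrite tpermD // eq_sym.
apply/setP=> u; apply/porbitP/porbitP=> -[i ->]; exists i; by rewrite E.
Qed.

Let C := porbit s y.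

Lemma porbits_insert :
  porbits r = (x |: C) |: (porbits s :\ C :\ [set x]).
Proof.
apply/setP=> D; rewrite !inE; apply/imsetP/idP.
  case=> z _ ->{D}.
  have [zx|nzx] := eqVneq z x; first by rewrite zx porbit_insert_in eqxx.
  have [zC|nzC] := boolP (z \in porbit s y).
    suff -> : porbit r z = porbit r x by rewrite porbit_insert_in eqxx.
    by apply/eqP; rewrite eq_porbit_mem porbit_insert_in !inE zC orbT.
  rewrite porbit_insert_out // imset_f // andbT.
  rewrite -fix_porbit !eq_porbit_mem nzC fix_porbit inE nzx.
  by rewrite orbT.
case/orP=> [/eqP->|/and3P[h1 h2 /imsetP[z _ E]]].
  by exists x; rewrite ?porbit_insert_in.
exists z => //; rewrite porbit_insert_out -?E //.
  by apply: contraNneq h1 => zx; rewrite E zx fix_porbit.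
by apply: contraNN h2; rewrite E eq_porbit_mem.
Qed.

Lemma insert_notin : x |: C \notin porbits s :\ C :\ [set x].
Proof.
rewrite !inE; apply/negP=> /and3P[h1 _ /imsetP[z _ E]].
have : x \in porbit s z by rewrite -E setU11.
by rewrite -eq_porbit_mem -E fix_porbit eq_sym (negPf h1).
Qed.

Lemma porbits_remove : porbits s = C |: ([set x] |: (porbits s :\ C :\ [set x])).
Proof.
rewrite setD1K ?setD1K ?imset_f // !inE -[in X in _ && X]fix_porbit imset_f // andbT.
by rewrite -fix_porbit eq_porbit_mem fix_notin_porbit.
Qed.

(** The cycles not touched by the insertion contribute the same [z] on both sides, so every additive
    or multiplicative cycle statistic can be compared before and after. *)
Lemma big_porbits_insert (R : Type) (idx : R) (op : Monoid.com_law idx)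
    (F : {set T} -> R) :
  exists2 z, \big[op/idx]_(D in porbits r) F D = op (F (x |: C)) z &
             \big[op/idx]_(D in porbits s) F D = op (F C) (op (F [set x]) z).
Proof.
exists (\big[op/idx]_(D in porbits s :\ C :\ [set x]) F D).
  by rewrite porbits_insert big_setU1 ?insert_notin.
rewrite {1}porbits_remove !big_setU1 //= ?inE ?eqxx ?andbF ?orbF //.
by rewrite -fix_porbit eq_porbit_mem porbit_sym fix_notin_porbit.
Qed.

Lemma card_porbits_insert : (#|porbits r|.+1 = #|porbits s|)%N.
Proof.
have [z] := big_porbits_insert addn (fun=> 1%N).
by rewrite !sum1_card => -> ->.
Qed.

End Insert.

Lemma perm_on_insert S s x y : x \notin S -> y \in x |: S -> perm_on S s ->
  perm_on (x |: S) (s * tperm x y)%g.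
Proof.
move=> xS yS sS; apply: perm_onM.
  by apply: subset_trans sS _; apply: subsetUr.
apply/subsetP=> z; rewrite inE => h; move: h yS; rewrite !inE.
by case: tpermP => [->|->|]; rewrite ?eqxx.
Qed.

Lemma perm_on_fix S s x : x \notin S -> perm_on S s -> s x = x.
Proof. by move=> xS sS; apply: out_perm sS xS. Qed.

(** A permutation of [x |: S] factors uniquely as [s * tperm x y] with [s] supported on [S], where
    [y] is the image of [x]. Iterated, this is the factorization behind the Jucys-Murphy
    elements. *)
Lemma big_perm_on_peel (R : Type) (idx : R) (op : Monoid.com_law idx)
    S x (F : {perm T} -> R) : x \notin S ->
  \big[op/idx]_(s | perm_on (x |: S) s) F s =
  \big[op/idx]_(s | perm_on S s) \big[op/idx]_(y in x |: S) F (s * tperm x y)%g.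
Proof.
move=> xS; rewrite pair_big_dep /=.
rewrite (reindex_onto (fun p : {perm T} * T => (p.1 * tperm x p.2)%g)
          (fun s => ((s * tperm x (s x))%g, s x))) /=; last first.
  by move=> s _; rewrite -mulgA tperm2 mulg1.
apply: eq_bigl => -[s y] /=; apply/andP/andP => -[].
  move=> sS /eqP[Es Ey]; split; last first.
    by rewrite -Ey (perm_closed _ sS) setU11.
  apply/subsetP=> z; rewrite inE /= => h.
  have zx : z != x.
    by apply: contraNneq h => ->; rewrite -Es Ey mul_tpermE Ey tpermR.
  have: z \in x |: S; last by rewrite !inE (negPf zx).
  apply: contraR h => zS; move: (out_perm sS zS); rewrite mul_tpermE => E.
  have yS : y \in x |: S by rewrite -Ey (perm_closed _ sS) setU11.
  apply/eqP; apply: (@perm_inj _ (tperm x y)); rewrite E tpermD //; apply: contraNneq zS => <- //.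
  by rewrite setU11.
move=> sS yS; have sx := perm_on_fix xS sS; split; first exact: perm_on_insert.
by rewrite mul_tpermE sx tpermL -mulgA tperm2 mulg1.
Qed.

(** The reflection length of [s], that is, the least number of transpositions with product [s]. *)
Definition absl s := (#|T| - #|porbits s|)%N.

Lemma leq_porbits s : (#|porbits s| <= #|T|)%N.
Proof. exact: leq_imset_card. Qed.

Lemma absl_insert S s x y : x \notin S -> perm_on S s ->
  absl (s * tperm x y)%g = (absl s + (y != x))%N.
Proof.
move=> xS sS; have [->|nyx] := eqVneq y x; first by rewrite tperm1 mulg1 addn0.
have := card_porbits_insert (perm_on_fix xS sS) nyx.
have := leq_porbits s; rewrite /absl.
set a := #|porbits s|; set b := #|porbits _|; set c := #|T|; clearbody a b c; lia.
Qed.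

Lemma porbits1 : #|porbits (1%g : {perm T})| = #|T|.
Proof.
rewrite card_imset // => x y /eqP; rewrite eq_porbit_mem.
by rewrite fix_porbit ?perm1 // inE => /eqP.
Qed.

Lemma absl1 : absl 1%g = 0%N.
Proof. by rewrite /absl porbits1 subnn. Qed.

End Peeling.

(** * Action of the Jucys-Murphy elements *)

Local Open Scope ring_scope.

Section JucysMurphy.

Variables (R : comNzRingType) (T : finType) (A : {set T}).
Implicit Types (G : (T -> T) -> R) (s : {perm T}) (S : {set T}).

(* The values of a linear form on the vectors spanning [Lambda^k] of the
   standard representation of the symmetric group, indexed by [k+1] points. *)
Record hook_form G : Prop := HookForm {
  hook_ext : forall c c', {in A, c =1 c'} -> G c = G c';
  hook_alt : forall c l m, l \in A -> m \in A -> l != m ->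
    G (c \o tperm l m) = - G c;
  hook_rel : forall c w,
    \sum_(l in A) G (fun i => if i == l then w else c i) = G c }.

Lemma hook_form_comp G (f : T -> T) : hook_form G -> hook_form (fun c => G (f \o c)).
Proof.
case=> gext galt grel; split.
- by move=> c c' E; apply: gext => i iA /=; rewrite E.
- by move=> c l m lA mA lm; exact: (galt (f \o c)).
- move=> c w; rewrite -(grel (f \o c) (f w)); apply: eq_bigr => l _.
  by apply: gext => i _ /=; case: ifP.
Qed.

Lemma perm_on0 s : perm_on (@set0 T) s = (s == 1%g).
Proof.
apply/idP/eqP => [h|->]; last exact: perm_on1.
by apply/permP=> x; rewrite perm1; apply: out_perm h _; rewrite inE.
Qed.

Definition jucys_sum S G (y : R) s :=
  \sum_(p : {perm T} | perm_on S p) y ^+ absl p * G (p \o s).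

(** In the group algebra, passing from [S] to [x |: S] multiplies the sum by [1 + y J_x], with [J_x]
    the sum of the transpositions of [x] with points of [S]. [F] holds the inductive value on [S],
    and [a] is the eigenvalue it takes at each [tperm x z \o s]. *)
Lemma jucys_sumU1 S x G y s (F : ((T -> T) -> R) -> R) (a : R) :
  x \notin S -> hook_form G ->
  (forall G', hook_form G' -> jucys_sum S G' y s = F G') ->
  (forall z, z \in x |: S -> F (fun c => G (tperm x z \o c)) = a * G (tperm x z \o s)) ->
  jucys_sum (x |: S) G y s =
  a * (G s + y * \sum_(z in S) G (tperm x z \o s)).
Proof.
move=> xS gG IH Fa; rewrite /jucys_sum big_perm_on_peel //= exchange_big /=.
rewrite big_setU1 //= mulrDr; congr (_ + _).
  have E := Fa _ (setU11 x S); rewrite tperm1 in E.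
  rewrite (_ : G s = G ((1%g : {perm T}) \o s)); last first.
    by apply: (hook_ext gG) => i _ /=; rewrite perm1.
  rewrite -E -IH; last exact: hook_form_comp.
  apply: eq_bigr => p pS; rewrite tperm1 mulg1; congr (_ * _).
  by apply: (hook_ext gG) => i _ /=; rewrite perm1.
rewrite !big_distrr /=; apply: eq_bigr => z zS.
have nzx : z != x by apply: contraNneq xS => <-.
rewrite mulrCA -Fa ?inE ?zS ?orbT // -IH; last exact: hook_form_comp.
rewrite mulr_sumr; apply: eq_bigr => p pS.
rewrite (absl_insert _ xS pS) nzx addn1 exprS -mulrA; congr (_ * (_ * _)).
by apply: (hook_ext gG) => i _ /=; rewrite permM.
Qed.

(** Exchanging two points of the image of [A] exchanges two arguments of an alternating form, so
    [J_x] acts by minus the number of points already in place. These are the contents of the corner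
    and leg of the hook. *)
Lemma jucys_sum_sub s y S : S \subset s @: A -> forall G, hook_form G ->
  jucys_sum S G y s = (\prod_(l < #|S|) (1 - l%:R * y)) * G s.
Proof.
have [n] := ubnP #|S|; elim: n S => // n IH S ltS SA G gG.
have [->|/set0Pn[x xS]] := eqVneq S set0.
  rewrite /jucys_sum (eq_bigl _ _ perm_on0) big_pred1_eq absl1 expr0 mul1r.
  rewrite cards0 big_ord0 mul1r.
  by apply: (hook_ext gG) => i _ /=; rewrite perm1.
have xS' : x \notin S :\ x by rewrite !inE eqxx.
have cS : #|S| = #|S :\ x|.+1 by rewrite (cardsD1 x S) xS.
have sub : S :\ x \subset s @: A by rewrite (subset_trans (subsetDl _ _)).
rewrite -{1}(setD1K xS).
rewrite (@jucys_sumU1 _ _ _ _ _ _ (\prod_(l < #|S :\ x|) (1 - l%:R * y)) xS' gG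
  (fun G' gG' => IH _ _ sub G' gG')) //; last by rewrite -ltnS -cS.
rewrite cS big_ord_recr /= -mulrA; congr (_ * _).
rewrite mulrBl mul1r; congr (_ + _).
rewrite (eq_bigr (fun=> - G s)); last first.
  move=> z zS; have /imsetP[l lA El] := subsetP SA _ xS.
  have /imsetP[m mA Em] := subsetP sub _ zS.
  rewrite -(@hook_alt _ gG s l m) //; last first.
    by move: zS; rewrite !inE => /andP[+ _]; apply: contraNneq => lm; rewrite Em El lm.
  apply: (hook_ext gG) => i iA /=; rewrite El Em.
  by rewrite inj_tperm //; exact: perm_inj.
by rewrite sumr_const -mulr_natl; ring.
Qed.

(** For [x] outside the image of [A], the transpositions with image points sum to [G s] by
    [hook_rel], and those with the remaining points leave [G s] unchanged. The eigenvalues 1, 2, ...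
    so obtained are the contents of the arm. *)
Lemma jucys_sum_sup s y S : s @: A \subset S -> forall G, hook_form G ->
  jucys_sum S G y s =
  (\prod_(l < #|A|) (1 - l%:R * y)) *
  (\prod_(l < #|S| - #|A|) (1 + l.+1%:R * y)) * G s.
Proof.
have cA : #|s @: A| = #|A| by rewrite card_imset //; exact: perm_inj.
have [n] := ubnP #|S|; elim: n S => // n IH S ltS AS G gG.
have [E|nE] := eqVneq (s @: A) S.
  rewrite -E jucys_sum_sub // cA subnn big_ord0 mulr1 //.
have /properP[_ [x xS xA]] : s @: A \proper S by rewrite properEneq nE.
have xS' : x \notin S :\ x by rewrite !inE eqxx.
have cS : #|S| = #|S :\ x|.+1 by rewrite (cardsD1 x S) xS.
have sub : s @: A \subset S :\ x.
  by apply/subsetP=> z zA; rewrite !inE (subsetP AS _ zA) andbT; apply: contraNneq xA => <-.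
rewrite -{1}(setD1K xS).
rewrite (@jucys_sumU1 _ _ _ _ _ _ ((\prod_(l < #|A|) (1 - l%:R * y)) *
  (\prod_(l < #|S :\ x| - #|A|) (1 + l.+1%:R * y))) xS' gG
  (fun G' gG' => IH _ _ sub G' gG')) //; last by rewrite -ltnS -cS.
have leA : (#|A| <= #|S :\ x|)%N by rewrite -cA subset_leq_card.
rewrite cS subSn // big_ord_recr /= -!mulrA; congr (_ * (_ * _)).
rewrite mulrDl mul1r; congr (_ + _).
rewrite (big_setID (s @: A)) /=.
have -> : (S :\ x) :&: (s @: A) = s @: A by apply/setIidPr.
rewrite big_imset /=; last by move=> a b _ _; exact: perm_inj.
have nx i : i \in A -> s i != x by move=> iA; apply: contraNneq xA => <-; rewrite imset_f.
rewrite -(@hook_rel _ gG s x) (eq_bigr (fun l => G (fun i => if i == l then x else s i))).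
  rewrite (hook_rel gG) (eq_bigr (fun=> G s)); last first.
    move=> z; rewrite !inE => /and3P[h1 h2 _]; apply: (hook_ext gG) => i iA /=.
    rewrite tpermD 1?eq_sym ?nx //; apply: contraNneq h1 => <-; exact: imset_f.
  rewrite sumr_const.
  have -> : #|(S :\ x) :\: s @: A| = (#|S :\ x| - #|A|)%N.
    by rewrite cardsD (setIidPr sub) cA.
  by rewrite -mulr_natl -(addn1 (_ - _)%N) natrD; ring.
move=> l lA; apply: (hook_ext gG) => i iA /=.
case: eqP => [->|/eqP nil]; first by rewrite tpermR.
by rewrite tpermD 1?eq_sym ?nx // (inj_eq perm_inj).
Qed.

Lemma prod_contents (y : R) k d : (k < d)%N ->
  (\prod_(l < k.+1) (1 - l%:R * y)) * (\prod_(l < d - k.+1) (1 + l.+1%:R * y)) =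
  \prod_(l < d) (1 + (l%:R - k%:R) * y).
Proof.
move=> ltkd; rewrite -(subnKC ltkd) addKn big_split_ord /=; congr (_ * _).
  rewrite (reindex_inj rev_ord_inj) /=; apply: eq_bigr => l _.
  by rewrite subSS natrB -1?ltnS //; ring.
by apply: eq_bigr => l _; rewrite -natr1 natrD -natr1; ring.
Qed.

(** With [S] the whole set, both products merge into the content product of the hook with leg length
    [k], independently of the chosen form. *)
Lemma jucys_sumT s y k : #|A| = k.+1 -> forall G, hook_form G ->
  \sum_p y ^+ absl p * G (s * p)%g =
  (\prod_(l < #|T|) (1 + (l%:R - k%:R) * y)) * G s.
Proof.
move=> cA G gG.
have ltk : (k < #|T|)%N by rewrite -cA max_card.
have := @jucys_sum_sup s y setT (subsetT _) _ gG.
rewrite cardsT cA prod_contents // => <-.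
rewrite /jucys_sum; apply: eq_big => [p|p _]; first by apply/esym/subsetP=> x _; rewrite inE.
by congr (_ * _); apply: (hook_ext gG) => i _ /=; rewrite permM.
Qed.

End JucysMurphy.

(** * Determinants of permutation matrices and hook characters *)

Section PermDet.

Variables (R : comNzRingType) (d : nat).
Implicit Types (s : 'S_d) (w : 'I_d -> R).

(** This is [1 - diag(w) P_s]. Separate weights for the rows keep the family closed under
    contracting a point of a cycle. *)
Definition wperm_mx s w : 'M[R]_d :=
  \matrix_(i, l) ((i == l)%:R - w i * (s i == l)%:R).

Definition cycle_prod s w := \prod_(D in porbits s) (1 - \prod_(i in D) w i).

Lemma cofactor_eq_row (M N : 'M[R]_d) x :
  (forall i l, i != x -> M i l = N i l) -> cofactor M x =1 cofactor N x.
Proof.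
move=> E l; rewrite /cofactor; congr (_ * \det _).
by apply/matrixP=> i j; rewrite !mxE E // eq_sym neq_lift.
Qed.

Lemma det_col_pivot (M : 'M[R]_d) x : (forall i, M i x = (i == x)%:R) ->
  \det M = cofactor M x x.
Proof.
move=> E; rewrite (expand_det_col M x) (bigD1 x) //= E eqxx mul1r big1 ?addr0 // => i nix.
by rewrite E (negPf nix) mul0r.
Qed.

(** The predecessor [p] absorbs the weight of [x], so the weight product of the cycle is kept;
    weight 0 makes the left-over fixed point [x] contribute the factor 1. *)
Definition contract_weight (x p : 'I_d) w i :=
  if i == x then 0 else if i == p then w p * w x else w i.

(* Adding [w p] times row [x] to row [p], where [p] precedes [x] in its cycle,
   clears column [x]: the point [x] is contracted into [p]. *)
Lemma det_wperm_insert s x y w : s x = x -> y != x ->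
  \det (wperm_mx (s * tperm x y)%g w) =
  \det (wperm_mx s (contract_weight x (s^-1 y)%g w)).
Proof.
move=> sx nyx; set p := (s^-1 y)%g; set r := (s * tperm x y)%g.
have sp : s p = y by rewrite permKV.
have npx : p != x by apply: contraNneq nyx => px; rewrite -sp px sx.
have rp : r p = x by rewrite mul_tpermE sp tpermR.
have rx : r x = y by rewrite mul_tpermE sx tpermL.
have rE i : i != x -> i != p -> r i = s i.
  move=> nix nip; rewrite mul_tpermE tpermD //.
    by rewrite -[X in X != _]sx (inj_eq perm_inj) eq_sym.
  by rewrite -sp (inj_eq perm_inj) eq_sym.
set N := wperm_mx r w; set N' := wperm_mx s _.
pose N1 : 'M[R]_d := \matrix_(i, l) if i == x then N x l else N' i l.
have N1p l : N1 p l = N p l + w p * N x l.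
  rewrite !mxE (negPf npx) /contract_weight (negPf npx) eqxx sp rp rx.
  by ring.
have N1E i l : i != p -> N1 i l = N i l.
  move=> nip; rewrite mxE; case: eqP => [->//|/eqP nix].
  by rewrite !mxE /contract_weight (negPf nix) (negPf nip) rE.
pose N2 : 'M[R]_d := \matrix_(i, l) if i == p then N x l else N i l.
(* Row [p] of [N1] is row [p] of [N] plus [w p] times row [x], and [N2] has two equal rows. *)
have -> : \det N = \det N1.
  rewrite (@determinant_multilinear _ _ N1 N N2 p 1 (w p)).
  - rewrite (@determinant_alternate _ _ N2 p x) //; first by rewrite mulr0 addr0 mul1r.
    by move=> l; rewrite [LHS]mxE [RHS]mxE eqxx [x == p]eq_sym (negPf npx).
  - by apply/rowP=> l; rewrite [LHS]mxE N1p !mxE eqxx mul1r.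
  - by apply/matrixP=> i l; rewrite [LHS]mxE [RHS]mxE N1E // eq_sym neq_lift.
  - apply/matrixP=> i l; rewrite [LHS]mxE [RHS]mxE N1E; last by rewrite eq_sym neq_lift.
    by rewrite mxE [_ == p]eq_sym (negPf (neq_lift _ _)).
have colN' i : N' i x = (i == x)%:R.
  rewrite mxE /contract_weight; case: eqP => [->|/eqP nix]; first by rewrite mul0r subr0.
  have /negPf-> : s i != x by rewrite -sx (inj_eq perm_inj).
  by rewrite mulr0 subr0.
rewrite (@det_col_pivot N1 x).
  by rewrite (@det_col_pivot N' x) //; apply: cofactor_eq_row => i l nix; rewrite mxE (negPf nix).
move=> i; rewrite mxE; case: eqP => [_|/eqP nix]; last by rewrite colN' (negPf nix).
by rewrite mxE rx (negPf nyx) eqxx mulr0 subr0.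
Qed.

Lemma cycle_prod_insert s x y w : s x = x -> y != x ->
  cycle_prod (s * tperm x y)%g w =
  cycle_prod s (contract_weight x (s^-1 y)%g w).
Proof.
move=> sx nyx; rewrite /cycle_prod (porbits_insert y sx).
rewrite big_setU1 ?insert_notin //= [in RHS](porbits_remove sx nyx).
have xC := fix_notin_porbit sx nyx; set C := porbit s y.
have nCx : C != [set x] by rewrite -(fix_porbit sx) eq_porbit_mem porbit_sym.
rewrite [RHS]big_setU1 /=; last by rewrite !inE (negPf nCx) eqxx andbF.
rewrite [X in _ = _ * X]big_setU1 /=; last by rewrite !inE eqxx.
set p := (s^-1 y)%g.
have pC : p \in C by rewrite -(porbit_step s y p) permKV porbit_id.
have npx : p != x by apply: contraNneq xC => <-.
rewrite [X in _ = _ * (X * _)](_ : _ = 1) ?mul1r; last first.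
  by rewrite big_set1 /contract_weight eqxx subr0.
congr ((1 - _) * _).
  rewrite big_setU1 //= (bigD1 p pC) [in RHS](bigD1 p pC) /=.
  rewrite /contract_weight (negPf npx) eqxx mulrCA mulrA; congr (_ * _).
  apply: eq_bigr => i /andP[iC nip]; rewrite (negPf nip).
  by case: eqP => // ix; move: xC; rewrite -ix => /negP[].
apply: eq_bigr => D; rewrite !inE => /and3P[nDx nDC /imsetP[u _ ED]].
congr (1 - _); apply: eq_bigr => i iD; rewrite /contract_weight.
have Di : D = porbit s i by apply/eqP; rewrite ED eq_sym eq_porbit_mem -ED.
case: eqP => [ix|_]; first by rewrite Di ix fix_porbit ?eqxx in nDx.
case: eqP => [ip|//]; move: nDC; rewrite Di ip => /negP[].
by rewrite eq_porbit_mem.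
Qed.

(** Induction on the number of moved points: both sides obey the same contraction rule, and for the
    identity the matrix is diagonal. *)
Lemma det_wperm s w : \det (wperm_mx s w) = cycle_prod s w.
Proof.
have [n] := ubnP #|[pred z | s z != z]|; elim: n s w => // n IH s w lt_n.
have [x nx|fixs] := pickP [pred z | s z != z]; last first.
  have -> : s = 1%g by apply/permP=> z; rewrite perm1; apply/eqP; move: (fixs z) => /= /negbFE.
  rewrite /cycle_prod /porbits big_imset /=; last first.
    move=> a b _ _ /eqP; rewrite eq_porbit_mem fix_porbit ?perm1 // inE => /eqP //.
  rewrite (_ : wperm_mx 1 w = diag_mx (\row_i (1 - w i))); last first.
    by apply/matrixP=> i l; rewrite !mxE perm1; case: eqP => _ /=; ring.
  rewrite det_diag; apply: eq_bigr => i _.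
  by rewrite mxE fix_porbit ?perm1 // big_set1.
set r := (s * tperm x (s x))%g.
have rx : r x = x by rewrite mul_tpermE tpermR.
have -> : s = (r * tperm x (s x))%g by rewrite -mulgA tperm2 mulg1.
rewrite (det_wperm_insert _ rx nx) (cycle_prod_insert _ rx nx); apply: IH.
rewrite -ltnS; apply: leq_trans lt_n; rewrite ltnS; apply: proper_card; apply/properP; split.
  apply/subsetP=> z; rewrite !inE; apply: contraNN => /eqP sz.
  rewrite mul_tpermE sz; case: tpermP => [zx|zsx|//]; first by rewrite -zx sz.
  by move: sz; rewrite {2}zsx => /perm_inj->.
by exists x; rewrite !inE ?rx ?eqxx.
Qed.

End PermDet.

(** * Generating polynomial of the hook characters *)

Section HookPoly.

Variable d : nat.
Implicit Types (s : 'S_d) (A : {set 'I_d}) (c : 'I_d -> 'I_d).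

(** For [j] in [A], the identity rows outside [A] reduce the determinant to a minor on [A] with row
    [j] replaced by ones; summing over [j] gives a bordered minor up to sign. An arbitrary map [c]
    is allowed because [hook_rel] overwrites single values. *)
Definition hook_mx (j : 'I_d) A c : 'M[rat]_d :=
  \matrix_(i, l) if i == j then 1 else if i \in A then (c i == l)%:R else (i == l)%:R.

Definition hook_det A c := \sum_(j in A) \det (hook_mx j A c).

Lemma det_row_tperm (M : 'M[rat]_d) l m : l != m ->
  \det (\matrix_(i, a) M (tperm l m i) a) = - \det M.
Proof.
move=> nlm; rewrite -[- _]mulN1r.
rewrite (_ : \matrix_(i, a) _ = row_perm (tperm l m) M); last first.
  by apply/matrixP=> i a; rewrite !mxE.
by rewrite row_permE det_mulmx det_perm odd_tperm nlm expr1.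
Qed.

(** Alternation is a row exchange. For the relation, expand into pairs of a replaced row [l] and a
    row [j] of ones: pairs with [l != j] cancel by exchanging the two rows, and for [l = j] the ones
    hide the replacement. *)
Lemma hook_det_form A : hook_form A (hook_det A).
Proof.
split.
- move=> c c' E; apply: eq_bigr => j jA; congr (\det _).
  apply/matrixP=> i l; rewrite !mxE; case: ifP => // _; case: ifP => // iA.
  by rewrite E.
- move=> c l m lA mA nlm; rewrite /hook_det (reindex_inj (@perm_inj _ (tperm l m))) /=.
  have tA i : (tperm l m i \in A) = (i \in A).
    by case: tpermP => [->|->|//]; rewrite lA mA.
  rewrite (eq_bigl _ _ tA) -sumrN; apply: eq_bigr => j jA.
  rewrite -(det_row_tperm _ nlm); congr (\det _); apply/matrixP=> i a; rewrite !mxE /=.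
  rewrite tA; have -> : (i == tperm l m j) = (tperm l m i == j).
    by rewrite -[in RHS](tpermK l m j) (inj_eq perm_inj).
  case: ifP => // _; case: ifP => // niA; rewrite tpermD //.
    by apply: contraFneq niA => <-.
  by apply: contraFneq niA => <-.
move=> c w.
pose D l j := \det (hook_mx j A (fun i => if i == l then w else c i)).
pose off := \sum_(l in A) \sum_(j in A | j != l) D l j.
have Dl l j : l \in A -> j \in A -> j != l -> D l j = - D j l.
  move=> lA jA njl; rewrite -(det_row_tperm _ njl); congr (\det _).
  apply/matrixP=> i a; rewrite !mxE /=.
  case: tpermP => [->|->|/eqP nij /eqP nil].
  - by rewrite !eqxx.
  - by rewrite [l == j]eq_sym !(negPf njl) lA jA !eqxx.
  - by rewrite (negPf nij) (negPf nil).
have offN : off = - off.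
  rewrite {1}/off (exchange_big_dep (mem A)) /=; last by move=> ? ? _ /andP[].
  rewrite -sumrN; apply: eq_bigr => j jA; rewrite -sumrN.
  apply: eq_big => [l|l /and3P[lA _ njl]]; first by rewrite jA eq_sym.
  exact: Dl.
have off0 : off = 0 by lra.
rewrite /hook_det (eq_bigr (fun l => D l l + \sum_(j in A | j != l) D l j)); last first.
  by move=> l lA; rewrite (bigD1 l).
rewrite big_split /= -/off off0 addr0; apply: eq_bigr => j jA; congr (\det _).
by apply/matrixP=> i a; rewrite !mxE; case: (i == j).
Qed.

Definition ones_mx s (j : 'I_d) : 'M[{poly rat}]_d :=
  \matrix_(i, l) if i == j then 1 else (i == l)%:R - 'X * (s i == l)%:R.

Definition hook_poly s := \sum_j \det (ones_mx s j).

(** Every row is split into two and the determinant expanded multilinearly; [A] records the rows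
    where the permutation part, or the row of ones, is chosen. Each chosen row other than [j]
    carries a factor [- 'X]. *)
Lemma hook_poly_minors s :
  hook_poly s = \sum_(A : {set 'I_d}) (- 'X) ^+ #|A|.-1 * (hook_det A s)%:P.
Proof.
rewrite /hook_poly.
pose F j i l : {poly rat} := if i == j then 1 else - 'X * (s i == l)%:R.
pose G (j i l : 'I_d) : {poly rat} := if i == j then 0 else (i == l)%:R.
have step j : \det (ones_mx s j) = \sum_(A : {set 'I_d} | j \in A)
    (- 'X) ^+ #|A|.-1 * (\det (hook_mx j A s))%:P.
  transitivity (\sum_(A : {set 'I_d})
      \det (\matrix_(i, l) if i \in A then F j i l else G j i l)).
    rewrite /determinant exchange_big /=; apply: eq_bigr => p _.
    rewrite (eq_bigr (fun i => F j i (p i) + G j i (p i))); last first.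
      move=> i _; rewrite mxE /F /G; case: ifP => _; first by rewrite addr0.
      by rewrite addrC mulNr.
    rewrite bigA_distr mulr_sumr; apply: eq_big => // A _; congr (_ * _).
    by apply: eq_bigr => i _; rewrite mxE.
  rewrite (bigID (fun A : {set 'I_d} => j \in A)) /= [X in _ + X]big1 ?addr0; last first.
    move=> A njA; rewrite /determinant big1 // => p _.
    by rewrite (bigD1 j) //= mxE (negPf njA) /G eqxx mul0r mulr0.
  apply: eq_bigr => A jA.
  rewrite (_ : \matrix_(i, l) _ =
    diag_mx (\row_i if i \in A :\ j then - 'X else 1) *m map_mx polyC (hook_mx j A s)).
    rewrite det_mulmx det_diag det_map_mx; congr (_ * _).
    rewrite (eq_bigr (fun i => if i \in A :\ j then - 'X else 1)); last by move=> i _; rewrite mxE.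
    by rewrite -big_mkcond /= prodr_const (cardsD1 j A) jA.
  apply/matrixP=> i l; rewrite mul_diag_mx !mxE /F /G in_setD1.
  case: eqP => [->|_] /=; first by rewrite jA mul1r.
  by case: ifP => _; rewrite ?mul1r rmorph_nat.
rewrite (eq_bigr _ (fun j _ => step j)) (exchange_big_dep predT) //=.
apply: eq_bigr => A _; rewrite -big_distrr /= /hook_det rmorph_sum //.
Qed.

Lemma coef_hook_poly s k :
  (hook_poly s)`_k = (-1) ^+ k * \sum_(A : {set 'I_d} | #|A| == k.+1) hook_det A s.
Proof.
rewrite hook_poly_minors coef_sum (bigID (fun A : {set 'I_d} => #|A| == k.+1)) /=.
rewrite mulr_sumr [X in _ + X]big1 ?addr0; last first.
  move=> A nA; rewrite coefMC -[- 'X]mulN1r exprMn -(rmorphN1 polyC) -rmorphXn /=.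
  rewrite coefCM coefXn; case: (posnP #|A|) => [A0|A0].
    by rewrite /hook_det (cards0_eq A0) big_set0 mulr0.
  case: eqP => [kA|_]; last by rewrite mulr0 mul0r.
  by move: nA; rewrite kA prednK ?eqxx.
apply: eq_bigr => A /eqP->; rewrite coefMC -[- 'X]mulN1r exprMn -(rmorphN1 polyC) -rmorphXn /=.
by rewrite coefCM coefXn eqxx mulr1.
Qed.

(** Here ['X] is the variable [y] marking reflection length, not the variable of [hook_poly], whose
    coefficients enter as constants. By [coef_hook_poly] these are combinations of hook forms on
    sets of size [k+1], all with the same eigenvalue. *)
Lemma jucys_hook_poly s k : (k < d)%N ->
  \sum_p 'X ^+ absl p * ((hook_poly (s * p)%g)`_k)%:P =
  (\prod_(l < d) (1 + (l%:R - k%:R) * 'X)) * ((hook_poly s)`_k)%:P.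
Proof.
move=> ltkd.
have gG A : hook_form A (fun c => (hook_det A c)%:P).
  have [gext galt grel] := hook_det_form A; split.
  - by move=> c c' /gext ->.
  - by move=> c l m lA mA nlm; rewrite galt // polyCN.
  - by move=> c w; rewrite -(grel c w) rmorph_sum.
rewrite coef_hook_poly polyCM rmorph_sum /= mulrCA !mulr_sumr.
rewrite (eq_bigr (fun p : 'S_d => \sum_(A : {set 'I_d} | #|A| == k.+1)
  ((-1) ^+ k)%:P * ('X ^+ absl p * (hook_det A (s * p)%g)%:P))).
  rewrite exchange_big; apply: eq_bigr => A /eqP cA.
  by rewrite -mulr_sumr (jucys_sumT _ _ cA (gG A)) card_ord.
move=> p _; rewrite coef_hook_poly polyCM rmorph_sum /= !mulr_sumr.
by apply: eq_bigr => A _; rewrite mulrCA.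
Qed.

(** The row [u] of ones satisfies [u N = (1 - 'X) u], hence [(1 - 'X) u adj(N) = det(N) u].
    Expanding [ones_mx s j] along its row of ones gives entry [j] of [u adj(N)]. *)
Lemma hook_poly_mul s : (1 - 'X) * hook_poly s =
  d%:R * \prod_(D in porbits s) (1 - 'X ^+ #|D|).
Proof.
pose N := wperm_mx s (fun=> 'X : {poly rat}).
have dN : \det N = \prod_(D in porbits s) (1 - 'X ^+ #|D|).
  by rewrite det_wperm; apply: eq_bigr => D _; rewrite prodr_const.
pose u : 'rV[{poly rat}]_d := const_mx 1.
have uN : u *m N = (1 - 'X) *: u.
  apply/rowP=> l; rewrite !mxE mulr1.
  rewrite (eq_bigr (fun i => (i == l)%:R - 'X * (s i == l)%:R)); last first.
    by move=> i _; rewrite !mxE mul1r.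
  rewrite sumrB -mulr_sumr.
  rewrite (bigD1 l) //= eqxx big1 ?addr0; last by move=> i /negPf->.
  rewrite (bigD1 (s^-1 l)%g) //= permKV eqxx big1 ?addr0 ?mulr1 //.
  by move=> i nil; case: eqP => // sil; rewrite -sil permK eqxx in nil.
have key : (1 - 'X) *: (u *m \adj N) = \det N *: u.
  by rewrite scalemxAl -uN -mulmxA mul_mx_adj mul_mx_scalar.
rewrite -dN mulr_sumr mulr_natl.
have -> : \det N *+ d = \sum_(j < d) \det N by rewrite sumr_const card_ord.
apply: eq_bigr => j _.
move/rowP: key => /(_ j); rewrite !mxE mulr1 => <-; congr (_ * _).
rewrite (expand_det_row _ j); apply: eq_bigr => l _; rewrite !mxE eqxx.
congr (_ * _); apply: cofactor_eq_row => i a nij; rewrite !mxE (negPf nij) //.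
Qed.

End HookPoly.

(** * Sizes of conjugacy classes *)

Local Open Scope nat_scope.

Section ClassSize.

Variable d : nat.
Implicit Types (s : 'S_d) (a : nat -> nat).

Definition ncyc_of s k := #|[set D in porbits s | #|D| == k]|.

Lemma ncyc_ofE s k : ncyc_of s k = \sum_(D in porbits s) (#|D| == k).
Proof.
rewrite /ncyc_of -sum1_card big_mkcond [RHS]big_mkcond; apply: eq_bigr => D _.
by rewrite inE; case: (D \in _); case: eqP.
Qed.

Lemma ncyc_of_insert s x y k : s x = x -> y != x ->
  ncyc_of (s * tperm x y)%g k + (k == 1) + (k == #|porbit s y|) =
  ncyc_of s k + (k == #|porbit s y|.+1).
Proof.
move=> sx nyx; rewrite !ncyc_ofE.
have [z -> ->] := big_porbits_insert sx nyx addn (fun D : {set _} => (#|D| == k) : nat).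
rewrite cards1 cardsU1 fix_notin_porbit // !(eq_sym k) add1n.
by rewrite -!addnA; lia.
Qed.

Lemma card_porbit_class s k : #|[set x | #|porbit s x| == k]| = k * ncyc_of s k.
Proof.
rewrite ncyc_ofE big_distrr /= -sum1_card.
rewrite (partition_big (porbit s) (mem (porbits s))) /=; last first.
  by move=> x _; rewrite imset_f.
apply: eq_bigr => D /imsetP[u _ ->].
case: eqP => [E|nE]; last first.
  rewrite muln0 big1 // => x; rewrite inE => /andP[/eqP h1 /eqP h2].
  by rewrite -h2 h1 in nE.
rewrite muln1 -E -[in RHS]sum1_card; apply: eq_bigl => x.
by rewrite inE -eq_porbit_mem; case: (porbit s x =P _) => [->|]; rewrite ?E ?eqxx ?andbF.
Qed.

Lemma card_porbit1 s x : (#|porbit s x| == 1) = (s x == x).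
Proof.
apply/cards1P/eqP => [[u E]|sx]; last by exists x; rewrite fix_porbit.
have: x \in [set u] by rewrite -E porbit_id.
have: s x \in [set u] by rewrite -E porbit_step porbit_id.
by rewrite !inE => /eqP-> /eqP->.
Qed.

(** Bounding [k] by [d] makes the condition boolean; longer cycles do not exist. *)
Definition cyc_class a := [set s | [forall k : 'I_d.+1, ncyc_of s k == a k]].

Lemma ncyc_of_big s k : d < k -> ncyc_of s k = 0.
Proof.
move=> ltk; rewrite ncyc_ofE big1 // => D _; case: eqP => // E.
by have := max_card (mem D); rewrite E card_ord leqNgt ltk.
Qed.

Lemma cyc_classP a s : (forall k, d < k -> a k = 0) ->
  reflect (forall k, ncyc_of s k = a k) (s \in cyc_class a).
Proof.
move=> a0; rewrite inE; apply: (iffP forallP) => [h k|h k]; last exact/eqP.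
have [ltk|lek] := ltnP d k; first by rewrite a0 // ncyc_of_big.
by have /eqP := h (Ordinal (lek : k < d.+1)).
Qed.

Definition incr a j k := a k + (k == j).

(** The order of the centralizer of a permutation with [a k] cycles of each length [k]. *)
Definition zee a := \prod_(k < d.+1) (k ^ a k * (a k)`!).

Lemma zee_incr a j : j <= d -> zee (incr a j) = j * (a j).+1 * zee a.
Proof.
move=> lej; pose j' : 'I_d.+1 := inord j.
have ej : j' = j :> nat by rewrite inordK.
rewrite /zee (bigD1 j') //= [in RHS](bigD1 j') //= ej /incr eqxx addn1.
rewrite expnS factS (eq_bigr (fun k : 'I_d.+1 => k ^ a k * (a k)`!)); first by nia.
by move=> k; rewrite -val_eqE /= ej => /negPf->; rewrite addn0.
Qed.

Lemma sum_incr (f : nat -> nat) a j : j <= d ->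
  \sum_(k < d.+1) f k * incr a j k = \sum_(k < d.+1) f k * a k + f j.
Proof.
move=> lej; pose j' : 'I_d.+1 := inord j.
have ej : j' = j :> nat by rewrite inordK.
rewrite (bigD1 j') //= [in RHS](bigD1 j') //= ej /incr eqxx addn1.
rewrite (eq_bigr (fun k : 'I_d.+1 => f k * a k)); first by nia.
by move=> k; rewrite -val_eqE /= ej => /negPf->; rewrite addn0.
Qed.

Lemma cyc_class_insert a s x y j : 0 < j < d -> (forall k, d < k -> a k = 0) ->
  s x = x -> y != x ->
  ((s * tperm x y)%g \in cyc_class (incr a j.+1)) && (#|porbit (s * tperm x y)%g x| == j.+1)
  = (s \in cyc_class (incr (incr a j) 1)) && (#|porbit s y| == j).
Proof.
move=> /andP[j0 ltj] a0 sx nyx.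
rewrite porbit_insert_in // cardsU1 fix_notin_porbit // add1n eqSS.
case: eqP => [E|]; rewrite ?andbF // !andbT.
apply/cyc_classP/cyc_classP.
- by move=> k ltk; rewrite /incr a0 //; case: eqP => // kj; lia.
- by move=> k ltk; rewrite /incr a0 //; case: eqP => [kj|_]; case: eqP => [kj'|_] //; lia.
- by move=> h k; have := ncyc_of_insert k sx nyx; rewrite h /incr E; lia.
- by move=> h k; have := ncyc_of_insert k sx nyx; rewrite h /incr E; lia.
Qed.

(* Double counting of pairs [(s, x)] with [x] on a cycle of length [j+1],
   according to [y = s x] and the permutation obtained by removing [x]. *)
Lemma card_cyc_class_incr a j : 0 < j < d -> (forall k, d < k -> a k = 0) ->
  #|cyc_class (incr a j.+1)| * (j.+1 * (a j.+1).+1) =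
  #|cyc_class (incr (incr a j) 1)| * ((incr a j 1).+1 * (j * (a j).+1)).
Proof.
move=> lj a0; have /andP[j0 ltj] := lj.
have lhs : #|cyc_class (incr a j.+1)| * (j.+1 * (a j.+1).+1) =
    \sum_x \sum_(s in cyc_class (incr a j.+1)) (#|porbit s x| == j.+1).
  rewrite exchange_big /= -sum_nat_const; apply: eq_bigr => s sK.
  have /cyc_classP E : s \in cyc_class (incr a j.+1) by [].
  have -> : (a j.+1).+1 = ncyc_of s j.+1.
    rewrite E /incr ?eqxx ?addn1 // => k ltk; rewrite a0 //; case: eqP => // kj; lia.
  rewrite -card_porbit_class -sum1_card big_mkcond /=; apply: eq_bigr => x _.
  by rewrite inE; case: eqP.
have rhs : #|cyc_class (incr (incr a j) 1)| * ((incr a j 1).+1 * (j * (a j).+1)) =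
    \sum_x \sum_(y | y != x) \sum_(s in cyc_class (incr (incr a j) 1))
      ((s x == x) && (#|porbit s y| == j)).
  rewrite (eq_bigr (fun x => \sum_(s in cyc_class (incr (incr a j) 1))
     \sum_(y | y != x) ((s x == x) && (#|porbit s y| == j)))); last first.
    by move=> x _; rewrite exchange_big.
  rewrite exchange_big /= -sum_nat_const; apply: eq_bigr => s sK.
  have /cyc_classP E : s \in cyc_class (incr (incr a j) 1) by [].
  have {}E k : ncyc_of s k = incr (incr a j) 1 k.
    apply: E => k' ltk; rewrite /incr a0 //; case: eqP => [kj|_]; case: eqP => [kj'|_] //; lia.
  have -> : (incr a j 1).+1 = ncyc_of s 1 by rewrite E /incr eqxx addn1.
  rewrite -[ncyc_of s 1]mul1n -card_porbit_class -sum1_card big_distrl /=.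
  rewrite big_mkcond /=; apply: eq_bigr => x _; rewrite inE card_porbit1.
  case: eqP => [sx|_] /=; last by rewrite big1.
  (* For [j = 1] the point [x] itself lies on a cycle of length [j] and has to be removed from the
     choices of [y]. *)
  rewrite mul1n -(addKn (j == 1) (j * _)).
  have -> : (j == 1) + j * (a j).+1 = j * ncyc_of s j.
    by rewrite E /incr eqxx; case: (eqVneq j 1) => [->|_]; rewrite ?eqxx; lia.
  rewrite -card_porbit_class -sum1_card [X in X - _](bigID (fun y => y == x)) /=.
  have -> : \sum_(y in [set y | #|porbit s y| == j] | y == x) 1 = (j == 1).
    rewrite big_mkcondl big_pred1_eq inE fix_porbit // cards1 eq_sym.
    by case: eqP.
  rewrite addKn big_mkcond [RHS]big_mkcond; apply: eq_bigr => y _.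
  by rewrite inE; case: (y != x); rewrite ?andbF ?andbT //; case: eqP.
rewrite lhs rhs; apply: eq_bigr => x _.
rewrite (partition_big (fun s : 'S_d => s x) predT) //= (bigD1 x) //= big1 ?add0n; last first.
  by move=> s /andP[_ /eqP sx]; rewrite fix_porbit // cards1; case: eqP => // ?; lia.
apply: eq_bigr => y nyx.
rewrite (reindex_inj (mulIg (tperm x y))) /= big_mkcond [RHS]big_mkcond; apply: eq_bigr => s _.
rewrite mul_tpermE -[y in _ == y](tpermL x y) (inj_eq perm_inj).
case: eqP => [sx|_]; rewrite ?andbF /=; last by case: ifP.
have iE (b c : bool) : (if b then c : nat else 0) = (b && c) by case: b.
by rewrite andbT !iE cyc_class_insert.
Qed.

(** Induction on the reflection length [sum (k - 1) a_k]: one cycle of length [b + 1 > 1] is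
    replaced by a cycle of length [b] and a fixed point, with the ratio of class sizes given by
    [card_cyc_class_incr]. At length 0 only the identity remains. *)
Lemma card_cyc_class a : 0 < d -> a 0 = 0 -> (forall k, d < k -> a k = 0) ->
  \sum_(k < d.+1) k * a k = d -> #|cyc_class a| * zee a = d`!.
Proof.
move=> d0; have [n] := ubnP (\sum_(k < d.+1) k.-1 * a k).
elim: n a => // n IH a ltn a00 a0 sa.
have [k /andP[k1 ak]|none] := pickP [pred k : 'I_d.+1 | (1 < k) && (0 < a k)].
  pose b := k.-1; have bk : b.+1 = k by rewrite prednK // ltnW.
  pose a1 i := a i - (i == b.+1).
  have aE : incr a1 b.+1 =1 a.
    by move=> i; rewrite /incr /a1; case: eqP => [->|_]; [rewrite bk|]; lia.
  have zeeE : zee (incr a1 b.+1) = zee a by apply: eq_bigr => i _; rewrite aE.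
  have clE : cyc_class (incr a1 b.+1) = cyc_class a.
    by apply/setP=> s; rewrite !inE; apply: eq_forallb => i; rewrite aE.
  have lb : 0 < b < d by have := ltn_ord k; lia.
  have a10 i : d < i -> a1 i = 0 by move=> /a0; rewrite /a1 => ->.
  have sumE (f : nat -> nat) : \sum_(i < d.+1) f i * a i = \sum_(i < d.+1) f i * incr a1 b.+1 i.
    by apply: eq_bigr => i _; rewrite aE.
  have ltb : b < d by case/andP: lb.
  rewrite -clE -zeeE zee_incr // mulnA card_cyc_class_incr //.
  rewrite -mulnA -(IH (incr (incr a1 b) 1)).
  - by rewrite zee_incr // zee_incr ?(ltnW ltb) // mul1n -!mulnA.
  - rewrite (sum_incr predn) // (sum_incr predn) ?(ltnW ltb) //=; move: ltn.
    rewrite (sumE predn) (sum_incr predn) //=.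
    by case/andP: lb; set z := \sum_(_ < _) _; clearbody z; lia.
  - by rewrite /incr /a1 a00 /=; lia.
  - by move=> i ltd; rewrite /incr a10 //; do 2?case: eqP => [?|_] //; lia.
  - rewrite (sum_incr id) // (sum_incr id) ?(ltnW ltb) //= -[RHS]sa (sumE id) (sum_incr id) //=.
    by rewrite -addnA addn1.
have ak0 (k : 'I_d.+1) : k != 1 :> nat -> a k = 0.
  move=> k1; have := none k => /=; case: (posnP (a k)) => // ak.
  rewrite andbT; case: (val k) k1 ak => [|[|m]] //=; by rewrite a00.
pose k1 : 'I_d.+1 := inord 1.
have e1 : k1 = 1 :> nat by rewrite inordK.
have a1 : a 1 = d.
  rewrite -[RHS]sa (bigD1 k1) //= e1 mul1n big1 ?addn0 // => k; rewrite -val_eqE /= e1 => h.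
  by rewrite ak0 ?muln0.
have -> : zee a = d`!.
  rewrite /zee (bigD1 k1) //= e1 exp1n mul1n a1 big1 ?muln1 // => k; rewrite -val_eqE /= e1 => h.
  by rewrite ak0.
suff -> : cyc_class a = [set 1%g] by rewrite cards1 mul1n.
have fix1 : ncyc_of 1 1 = d.
  rewrite -[LHS]mul1n -card_porbit_class -[RHS]card_ord -cardsT; congr #|pred_of_set _|.
  by apply/setP=> x; rewrite !inE card_porbit1 perm1 eqxx.
apply/setP=> s; rewrite in_set1; apply/cyc_classP/eqP => // [h|-> k].
  apply/permP=> x; rewrite perm1; apply/eqP; rewrite -card_porbit1.
  have : #|[set x | #|porbit s x| == 1]| = d by rewrite card_porbit_class h mul1n.
  move=> E; have : [set x | #|porbit s x| == 1] = setT.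
    by apply/eqP; rewrite eqEcard subsetT E cardsT card_ord leqnn.
  by move/setP/(_ x); rewrite !inE.
have [->|nk1] := eqVneq k 1; first by rewrite fix1.
have -> : a k = 0.
  have [ltk|lek] := ltnP d k; first exact: a0.
  exact: (ak0 (Ordinal (lek : k < d.+1))).
rewrite ncyc_ofE big1 // => D /imsetP[x _ ->].
by rewrite fix_porbit ?perm1 // cards1 eq_sym (negPf nk1).
Qed.

Lemma mem_leq_sumn k b : k \in b -> k <= sumn b.
Proof. by move=> kb; rewrite (perm_sumn (perm_to_rem kb)) leq_addr. Qed.

Lemma perm_undup_index_iota b : sumn b = d ->
  perm_eq (undup b) [seq k <- index_iota 0 d.+1 | k \in b].
Proof.
move=> bd; apply: uniq_perm; rewrite ?undup_uniq ?filter_uniq ?iota_uniq // => k.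
rewrite mem_undup mem_filter mem_index_iota /= ltnS -bd.
by case: (boolP (k \in b)) => // /mem_leq_sumn->.
Qed.

Lemma cycle_type_count s b : all (leq 1) b -> sumn b = d ->
  (cycle_type s == sort geq b) = (s \in cyc_class (fun k => count_mem k b)).
Proof.
move=> bpos bd.
have bb k : d < k -> count_mem k b = 0.
  move=> ltk; apply/count_memPn; apply: contraL ltk => kb; rewrite -leqNgt -bd.
  exact: mem_leq_sumn.
have geq_sort u v : (sort geq u == sort geq v) = perm_eq u v.
  apply/eqP/(@perm_sortP _ geq) => //.
  - by move=> m n; rewrite /geq /= orbC leq_total.
  - by move=> n m p; rewrite /geq /= => h1 h2; apply: leq_trans h2 h1.
  - by move=> m n; rewrite /geq /= => h; apply/eqP; rewrite eqn_leq andbC.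
rewrite /cycle_type geq_sort.
have cE k : count_mem k [seq #|pred_of_set C| | C in porbits s] = ncyc_of s k.
  rewrite count_map -sum1_count big_enum_cond /ncyc_of -sum1_card.
  by apply: eq_bigl => C; rewrite inE.
apply/idP/(cyc_classP _ bb) => [/seq.permP h k|h]; first by rewrite -cE h.
by apply/allP => k _ /=; rewrite cE h.
Qed.

Lemma zee_count b : all (leq 1) b -> sumn b = d ->
  zee (fun k => count_mem k b) = autb b * \prod_(x <- b) x.
Proof.
move=> bpos bd.
rewrite /autb -(big_undup_iterop_count _ b) -big_split /=.
rewrite (perm_big _ (perm_undup_index_iota bd)).
rewrite big_filter big_mkcond big_mkord; apply: eq_bigr => k _.
case: ifP => kb; first by rewrite mulnC expnE.
by move/negbT/count_memPn: kb => ->.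
Qed.

Lemma card_cycle_type b : 0 < d -> all (leq 1) b -> sumn b = d ->
  #|[set s : 'S_d | cycle_type s == sort geq b]| * (autb b * \prod_(x <- b) x) = d`!.
Proof.
move=> d0 bpos bd; rewrite -zee_count // -(@card_cyc_class (fun k => count_mem k b)) //.
- by congr (#|pred_of_set _| * _); apply/setP=> s; rewrite inE cycle_type_count.
- by apply/count_memPn; apply/negP=> /(allP bpos).
- move=> k ltk; apply/count_memPn; apply: contraL ltk => kb; rewrite -leqNgt -bd.
  exact: mem_leq_sumn.
rewrite -[RHS]bd sumnE -(big_undup_iterop_count _ b).
rewrite (perm_big _ (perm_undup_index_iota bd)).
rewrite big_filter [RHS]big_mkcond big_mkord; apply: eq_bigr => k _.
case: ifP => kb; first by rewrite Monoid.iteropE iter_addn_0.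
by move/negbT/count_memPn: kb => ->; rewrite muln0.
Qed.

End ClassSize.

(** * Hurwitz numbers as sums over hooks *)

Local Open Scope ring_scope.

Section HookClassFunction.

Variable d : nat.
Implicit Types (s t p : 'S_d).

Lemma porbitC s t x : porbit (t * s)%g (s x) = s @: porbit (s * t)%g x.
Proof.
have E i : ((t * s) ^+ i)%g (s x) = s (((s * t) ^+ i)%g x).
  by elim: i => [|i IH]; rewrite ?expg0 ?perm1 // !expgSr !permM IH.
apply/setP=> z; apply/porbitP/imsetP => [[i ->]|[u /porbitP[i ->] ->]].
  by exists (((s * t) ^+ i)%g x); rewrite ?mem_porbit // E.
by exists i; rewrite E.
Qed.

Lemma porbitsC s t : porbits (t * s)%g = (fun D : {set 'I_d} => s @: D) @: porbits (s * t)%g.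
Proof.
apply/setP=> D; apply/imsetP/imsetP => [[x _ ->]|[_ /imsetP[x _ ->] ->]].
  exists (porbit (s * t)%g (s^-1 x)%g); first exact: imset_f.
  by rewrite -porbitC permKV.
by exists (s x); rewrite // porbitC.
Qed.

Lemma one_subX_neq0 : 1 - 'X != 0 :> {poly rat}.
Proof. by rewrite subr_eq0 eq_sym; apply/negP=> /eqP/polyP/(_ 0%N); rewrite coefX coef1. Qed.

Lemma hook_poly_eq s t :
  \prod_(D in porbits s) (1 - 'X ^+ #|D|) =
    \prod_(D in porbits t) (1 - 'X ^+ #|D|) :> {poly rat} ->
  hook_poly s = hook_poly t.
Proof. by move=> E; apply: (mulfI one_subX_neq0); rewrite !hook_poly_mul E. Qed.

Lemma hook_polyC s t : hook_poly (t * s)%g = hook_poly (s * t)%g.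
Proof.
apply: hook_poly_eq; rewrite porbitsC big_imset /=; last first.
  by move=> A B _ _; apply: imset_inj; exact: perm_inj.
by apply: eq_bigr => D _; rewrite card_imset //; exact: perm_inj.
Qed.

Lemma hook_polyV s : hook_poly s^-1%g = hook_poly s.
Proof. by apply: hook_poly_eq; rewrite porbitsV. Qed.

Lemma size_hook_poly s : (size (hook_poly s) <= d)%N.
Proof.
apply/leq_sizeP => k lek; rewrite coef_hook_poly big_pred0 ?mulr0 // => A.
by apply/eqP=> E; have := max_card (mem A); rewrite E card_ord ltnNge lek.
Qed.

Definition content_poly k : {poly rat} := \prod_(l < d) (1 + (l%:R - k%:R) * 'X).

(** The coefficient of [y^q] in [jucys_hook_poly]: the eigenvalue is the elementary symmetric
    function of degree [q] in the contents. *)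
Lemma hook_eigen s k q : (k < d)%N ->
  \sum_(p | absl p == q) (hook_poly (s * p)%g)`_k =
  (content_poly k)`_q * (hook_poly s)`_k.
Proof.
move=> ltkd; have := jucys_hook_poly s ltkd => /(congr1 (fun u : {poly rat} => u`_q)).
rewrite coefMC => <-; rewrite coef_sum big_mkcond; apply: eq_bigr => p _.
by rewrite coefMC coefXn eq_sym; case: eqP; rewrite ?mul1r ?mul0r.
Qed.

Lemma absl_ncycles p q : (q <= d)%N -> (absl p == q) = (ncycles p == d - q)%N.
Proof.
move=> leq; have := leq_porbits p; rewrite /absl /ncycles card_ord.
set z := #|porbits p|; clearbody z; lia.
Qed.

Lemma absl0 p : (absl p == 0)%N = (p == 1%g).
Proof.
apply/eqP/eqP => [a0|->]; last exact: absl1.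
apply/permP=> x; rewrite perm1.
have E : #|porbits p| = #|'I_d|.
  by apply/eqP; rewrite eqn_leq leq_porbits -subn_eq0; apply/eqP.
have /imset_injP inj : #|porbit p @: 'I_d| == #|'I_d| by apply/eqP.
by apply: inj => //; apply/eqP; rewrite eq_porbit_mem porbit_step porbit_id.
Qed.

(** Detaching a moved point lowers [absl] by one, so a permutation with [absl] equal to 1 becomes
    the identity after one transposition. *)
Lemma is_transpositionE p : is_transposition p = (absl p == 1%N).
Proof.
apply/existsP/eqP => [[x /existsP[y /andP[nxy /eqP->]]]|a1].
  have := @absl_insert _ set0 1%g x y; rewrite mul1g absl1 eq_sym nxy => -> //.
    by rewrite inE.
  exact: perm_on1.
have [x nx|fixp] := pickP (fun x => p x != x); last first.
  have p1 : p = 1%g by apply/permP=> x; rewrite perm1; apply/eqP/negbFE/fixp.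
  by rewrite p1 absl1 in a1.
exists x; apply/existsP; exists (p x); rewrite eq_sym nx /=.
set r := (p * tperm x (p x))%g.
have rx : r x = x by rewrite mul_tpermE tpermR.
have pE : p = (r * tperm x (p x))%g by rewrite -mulgA tperm2 mulg1.
have r_on : perm_on [set~ x] r.
  by apply/subsetP=> z; rewrite !inE; apply: contraNneq => ->; rewrite rx.
have : absl r == 0%N.
  have := @absl_insert _ [set~ x] r x (p x); rewrite -pE a1 nx addn1 => h.
  by rewrite -eqSS -h // !inE eqxx.
by rewrite absl0 => /eqP r1; rewrite {1}pE r1 mul1g.
Qed.

(** Evaluate at 1. One cycle is used to cancel [1 - 'X], leaving a geometric sum; any further cycle
    leaves a factor vanishing at 1. For a [d]-cycle the geometric sum gives one factor [d] and
    [hook_poly] carries another. *)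
Lemma sum_coef_hook s : (0 < d)%N ->
  \sum_(k < d) (hook_poly s)`_k = (d * d)%:R * (cycle_type s == [:: d])%:R.
Proof.
move=> d0.
have -> : \sum_(k < d) (hook_poly s)`_k = (hook_poly s).[1].
  rewrite (horner_coef_wide _ (size_hook_poly s)); apply: eq_bigr => k _.
  by rewrite expr1n mulr1.
pose gs n : {poly rat} := \sum_(i < n) 'X^i.
have gsE n : 1 - 'X^n = (1 - 'X) * gs n.
  by rewrite -opprB subrX1 -mulNr opprB.
have gs1 n : (gs n).[1] = n%:R.
  rewrite horner_sum (eq_bigr (fun=> 1)) ?sumr_const ?card_ord // => i _.
  by rewrite hornerXn expr1n.
pose x0 := Ordinal d0.
have -> : hook_poly s = d%:R%:P * (gs #|porbit s x0| *
    \prod_(D in porbits s | D != porbit s x0) (1 - 'X^#|D|)).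
  apply: (mulfI one_subX_neq0); rewrite hook_poly_mul (bigD1 (porbit s x0)) ?imset_f //=.
  by rewrite gsE rmorph_nat; ring.
rewrite hornerCM.
have ct : cycle_type s = [:: d] -> forall D, D \in porbits s -> D = porbit s x0.
  move=> E; have : size (cycle_type s) = 1%N by rewrite E.
  rewrite size_sort size_map -cardE => /eqP/cards1P[C EC] D.
  have : porbit s x0 \in porbits s by exact: imset_f.
  by rewrite EC !inE => /eqP-> /eqP.
have tc : (forall D, D \in porbits s -> D = porbit s x0) -> cycle_type s = [:: d].
  move=> h; have E : porbits s = [set setT].
    have eT : porbit s x0 = setT.
      by apply/setP=> z; rewrite -(h (porbit s z) (imset_f _ _)) // porbit_id inE.
    apply/setP=> D; rewrite inE; apply/idP/eqP => [/h->//|->].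
    by rewrite -eT imset_f.
  rewrite /cycle_type (_ : [seq _ | C in _] = [:: d]) //.
  by rewrite /image_mem E enum_set1 /= cardsT card_ord.
case: eqP => [E|nE].
  rewrite big_pred0 => [|D]; last first.
    by apply/negP=> /andP[/(ct E)->]; rewrite eqxx.
  have -> : #|porbit s x0| = d.
    have: d \in cycle_type s by rewrite E inE.
    by rewrite mem_sort => /imageP[D Ds eD]; rewrite [RHS]eD (ct E D Ds).
  by rewrite mulr1 gs1 mulr1 natrM.
have /exists_inP[D Ds nD] : [exists D in porbits s, D != porbit s x0].
  apply: contra_notT nE; rewrite negb_exists_in => /forall_inP h.
  by apply: tc => D /h/negPn/eqP.
rewrite (bigD1 D) ?Ds //= !hornerM [X in _ * (_ * (X * _))](_ : _ = 0).
  by rewrite !(mul0r, mulr0).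
by rewrite !hornerE expr1n subrr.
Qed.

(** Each entry of the tuple acts by the same averaging operator, so [t] entries give [lam ^+ t]; [F]
    and [G] split off the last entry. *)
Lemma sum_ffun_eigen (h : 'S_d -> rat) (P : pred 'S_d) (lam : rat) (t : nat) :
  (forall s, \sum_(p | P p) h (p * s)%g = lam * h s) ->
  forall s, \sum_(f : {ffun 'I_t -> 'S_d} | [forall i, P (f i)])
     h ((\prod_(i < t) f i) * s)%g = lam ^+ t * h s.
Proof.
move=> hP; elim: t => [|t IH] s.
  have f0 (f : {ffun 'I_0 -> 'S_d}) : f = [ffun=> 1%g] by apply/ffunP=> -[m].
  rewrite (big_pred1 [ffun=> 1%g]) => [|f]; last first.
    by rewrite /= (f0 f) eqxx; apply/forallP => -[].
  by rewrite big_ord0 mul1g expr0 mul1r.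
pose F (x : {ffun 'I_t -> 'S_d} * 'S_d) : {ffun 'I_t.+1 -> 'S_d} :=
  [ffun i => if unlift ord_max i is Some j then x.1 j else x.2].
pose G (f : {ffun 'I_t.+1 -> 'S_d}) : {ffun 'I_t -> 'S_d} * 'S_d :=
  ([ffun j => f (lift ord_max j)], f ord_max).
have Fl x j : F x (lift ord_max j) = x.1 j by rewrite ffunE liftK.
have Fm x : F x ord_max = x.2 by rewrite ffunE unlift_none.
have FG : cancel F G.
  by move=> [f p]; rewrite /G Fm; congr (_, _); apply/ffunP=> j; rewrite ffunE Fl.
have GF : cancel G F.
  move=> f; apply/ffunP=> i; case: (unliftP ord_max i) => [j ->|->].
    by rewrite Fl ffunE.
  by rewrite Fm.
rewrite (reindex F) /=; last by exists G => x _; rewrite ?FG ?GF.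
transitivity (\sum_(p | P p) \sum_(f : {ffun 'I_t -> 'S_d} | [forall i, P (f i)])
   h ((\prod_(i < t) f i) * (p * s))%g).
  rewrite exchange_big pair_big /=; apply: eq_big => [[f p]|[f p] _] /=.
    apply/forallP/andP => [hf|[/forallP hf Pp] i].
      by split; [apply/forallP=> j; have := hf (lift ord_max j); rewrite Fl|have := hf ord_max; rewrite Fm].
    by case: (unliftP ord_max i) => [j ->|->]; rewrite ?Fl ?Fm.
  congr (h _); rewrite big_ord_recr /= Fm mulgA; congr (_ * _ * _)%g.
  apply: eq_bigr => j _; rewrite (_ : widen_ord _ j = lift ord_max j) ?Fl //.
  by apply: val_inj; rewrite /= /bump leqNgt ltn_ord.
rewrite (eq_bigr _ (fun p _ => IH (p * s)%g)) -mulr_sumr hP mulrA.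
by rewrite -exprSr.
Qed.

Lemma hurwitzN_sum (t q : nat) b : (0 < d)%N -> (q <= d)%N ->
  (hurwitzN d t (d - q) b)%:R * (d * d)%:R =
  \sum_(s : 'S_d | cycle_type s == sort geq b) \sum_(k < d)
    (content_poly k)`_1 ^+ t * (content_poly k)`_q * (hook_poly s)`_k :> rat.
Proof.
move=> d0 leqd; rewrite /hurwitzN.
pose Q (f : {ffun 'I_t -> 'S_d}) := [forall i, is_transposition (f i)].
pose I s : rat := (cycle_type s == [:: d])%:R.
have -> : (#|[set x : 'S_d * {ffun 'I_t -> 'S_d} * 'S_d |
      [&& cycle_type x.1.1 == [:: d], [forall i, is_transposition (x.1.2 i)],
          cycle_type x.2 == sort geq b &
          ncycles (x.1.1 * (\prod_(i < t) x.1.2 i) * x.2)%g == (d - q)%N]]|)%:R =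
    \sum_(s : 'S_d | cycle_type s == sort geq b) \sum_(f | Q f)
      \sum_(s0 : 'S_d | absl (s0 * (\prod_(i < t) f i * s))%g == q) I s0 :> rat.
  rewrite (exchange_big_dep predT) //= -sum1_card natr_sum.
  transitivity (\sum_(s0 : 'S_d) \sum_(f : {ffun 'I_t -> 'S_d}) \sum_(s : 'S_d)
    [&& cycle_type s0 == [:: d], Q f, cycle_type s == sort geq b &
          ncycles (s0 * (\prod_(i < t) f i) * s)%g == (d - q)%N]%:R : rat).
    rewrite pair_big pair_big /= big_mkcond /=; apply: eq_bigr => -[[s0 f] s] _ /=.
    by rewrite inE /= -/(Q f); case: ifP.
  rewrite exchange_big /=; apply: eq_bigr => f _.
  rewrite exchange_big /= [RHS]big_mkcond; apply: eq_bigr => s _.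
  case: ifP => [/andP[cs Qf]|nc].
    rewrite [RHS]big_mkcond; apply: eq_bigr => s0 _; rewrite absl_ncycles // mulgA /I cs Qf.
    by case: (_ == _ :> seq _); case: ifP.
  by rewrite big1 // => s0 _; move: nc; case: (Q f); case: (_ == sort _ _); rewrite ?andbF.
rewrite mulr_suml; apply: eq_bigr => s cs.
(* Writing [s0] as [p r^-1] with [absl p == q] turns the condition on the product into the sum of
   [hook_eigen]; [hook_polyV] and [hook_polyC] remove the inverse and the order of the factors. *)
have inner r : (d * d)%:R * (\sum_(s0 : 'S_d | absl (s0 * r)%g == q) I s0) =
    \sum_(k < d) (content_poly k)`_q * (hook_poly r)`_k.
  rewrite mulr_sumr (reindex_inj (mulIg r^-1%g)) /=.
  under eq_bigl do rewrite mulgKV.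
  under eq_bigr do rewrite /I -sum_coef_hook //.
  rewrite exchange_big /=; apply: eq_bigr => k _.
  rewrite -[hook_poly r]hook_polyV -hook_eigen //; apply: eq_bigr => p _.
  by rewrite hook_polyC.
rewrite mulrC mulr_sumr (eq_bigr _ (fun f _ => inner _)) exchange_big /=.
apply: eq_bigr => k _; rewrite -mulr_sumr.
rewrite (sum_ffun_eigen (h := fun r => (hook_poly r)`_k) (lam := (content_poly k)`_1)).
  by ring.
move=> r; rewrite -hook_eigen //; apply: eq_big => [p|p _]; first exact: is_transpositionE.
by rewrite hook_polyC.
Qed.

End HookClassFunction.

Lemma hook_poly_cycle_type d (s : 'S_d) b (Phi : {poly rat}) :
  cycle_type s = sort geq b -> (1 - 'X) * Phi = \prod_(x <- b) (1 - 'X^x) ->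
  hook_poly s = d%:R * Phi.
Proof.
move=> cs hPhi; apply: (mulfI one_subX_neq0); rewrite hook_poly_mul mulrCA hPhi.
congr (_ * _).
have pb : perm_eq b [seq #|pred_of_set C| | C in porbits s].
  by rewrite -(perm_sort geq b) -cs perm_sort.
by rewrite (perm_big _ pb) /= big_map big_enum.
Qed.

(** All permutations of type [b] contribute equally, and the class size cancels [Aut(b) / d!] down
    to the inverse of the product of the parts. Of the two factors [d] from [sum_coef_hook], one
    cancels against [hook_poly = d Phi]. *)
Lemma hurwitz_hook_sum (g q : nat) (b : seq nat) (Phi : {poly rat}) :
  let d := sumn b in let t := (2 * g + size b - 1 - q)%N in
  (0 < d)%N -> (q <= d)%N -> all (leq 1) b ->
  (1 - 'X) * Phi = \prod_(x <- b) (1 - 'X^x) ->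
  hurwitz g (d - q) b =
    (\sum_(k < d) (content_poly d k)`_1 ^+ t * (content_poly d k)`_q * Phi`_k)
      / (d%:R * \prod_(x <- b) x%:R).
Proof.
move=> d t d0 leqd bpos hPhi; rewrite /hurwitz -/d.
have -> : (2 * g + size b + (d - q) - (d + 1) = t)%N by rewrite /t; lia.
have dn0 : d%:R != 0 :> rat by rewrite pnatr_eq0 -lt0n.
set S := \sum_(k < d) _.
have := hurwitzN_sum t b d0 leqd.
have -> : \sum_(s : 'S_d | cycle_type s == sort geq b) \sum_(k < d)
    (content_poly d k)`_1 ^+ t * (content_poly d k)`_q * (hook_poly s)`_k =
    #|[set s : 'S_d | cycle_type s == sort geq b]|%:R * (d%:R * S).
  rewrite mulr_natl -sumr_const; apply: eq_big => [s|s /eqP cs]; first by rewrite inE.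
  rewrite (hook_poly_cycle_type cs hPhi) mulr_sumr; apply: eq_bigr => k _.
  by rewrite mulr_natl coefMn -mulr_natl; ring.
have /(congr1 (fun n => n%:R : rat)) := card_cycle_type d0 bpos erefl.
rewrite -/d !natrM natr_prod.
set N := (hurwitzN _ _ _ _)%:R; set K := #|_|%:R; set p := \prod_(x <- b) _ => hK hN.
have pn0 : p != 0.
  rewrite prodf_seq_neq0; apply/allP => x xb; apply/implyP=> _.
  by rewrite pnatr_eq0 -lt0n (allP bpos).
have fn0 : (d`!)%:R != 0 :> rat by rewrite pnatr_eq0 -lt0n fact_gt0.
have -> : N = K * S / d%:R.
  apply: (mulIf dn0); apply: (mulIf dn0); rewrite -mulrA hN; field => //.
have [Kn0 an0] : K != 0 /\ (autb b)%:R != 0 :> rat.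
  by move: fn0; rewrite -hK !mulf_eq0 !negb_or => /and3P[-> ->].
by rewrite -hK; field; rewrite ?pn0 ?dn0 ?Kn0 ?an0.
Qed.

(** * Elementary symmetric functions of contents *)

(** The leading term is removed by a multiple of the central difference of ['X^(N+1)], and the rest
    follows by induction. The coefficient identity says that the leading terms behave as for
    ordinary integration; its guard covers the empty case [N = 0]. *)
Lemma central_antiderivative N (p : {poly rat}) : (size p <= N)%N ->
  exists F : {poly rat}, [/\ (size F <= N.+1)%N, F`_N *+ N = p`_N.-1 *+ (N != 0%N) &
    forall x : rat, F.[x + 2^-1] - F.[x - 2^-1] = p.[x]].
Proof.
elim: N p => [|N IH] p sp.
  exists 0; split; rewrite ?size_poly0 //.
  by move: sp; rewrite leqn0 size_poly_eq0 => /eqP-> x; rewrite !horner0 subr0.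
pose h : rat := 2^-1.
(* The quotient of [(x + h)^(N+1) - (x - h)^(N+1)] by the difference of the bases, which is 1; its
   [N + 1] summands are monic of degree [N]. *)
pose D : {poly rat} := \sum_(i < N.+1) ('X - (- h)%:P) ^+ (N - i) * ('X - h%:P) ^+ i.
have mon (c : rat) : 'X - c%:P \is monic by exact: monicXsubC.
have tD (i : 'I_N.+1) : ('X - (- h)%:P) ^+ (N - i) * ('X - h%:P) ^+ i \is monic.
  by rewrite monicMl ?monic_exp ?mon.
have sD (i : 'I_N.+1) : size (('X - (- h)%:P) ^+ (N - i) * ('X - h%:P) ^+ i) = N.+1.
  rewrite (size_monicM (monic_exp _ (mon _))) ?monic_neq0 ?monic_exp ?mon // !size_exp_XsubC addSn addnS /=.
  by rewrite subnK // -ltnS.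
have DN : D`_N = N.+1%:R.
  rewrite coef_sum (eq_bigr (fun=> 1)) ?sumr_const ?card_ord // => i _.
  by rewrite -(monicP (tD i)) lead_coefE sD.
have sDN : (size D <= N.+1)%N.
  by apply: leq_trans (size_sum _ _ _) _; apply/bigmax_leqP => i _; rewrite sD.
have DE x : (x + h) ^+ N.+1 - (x - h) ^+ N.+1 = D.[x].
  rewrite subrXX (_ : x + h - (x - h) = 1) ?mul1r; last by rewrite /h; field.
  by rewrite horner_sum; apply: eq_bigr => i _; rewrite hornerM !horner_exp !hornerXsubC opprK.
have N0 : N.+1%:R != 0 :> rat by rewrite pnatr_eq0.
pose c := p`_N / N.+1%:R.
have sr : (size (p - c *: D)%R <= N)%N.
  apply/leq_sizeP => j; rewrite leq_eqVlt => /orP[/eqP<-|ltj].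
    by rewrite coefB coefZ DN /c mulfVK ?subrr.
  have /leq_sizeP h1 := sp; have /leq_sizeP h2 := sDN.
  by rewrite coefB coefZ h1 // h2 // mulr0 subrr.
have [F [sF _ FE]] := IH _ sr.
exists (c *: 'X^(N.+1) + F); split.
- apply: leq_trans (size_polyD _ _) _; rewrite geq_max (leq_trans sF) // andbT.
  by apply: leq_trans (size_scale_leq _ _) _; rewrite size_polyXn.
- rewrite coefD coefZ coefXn eqxx mulr1 (nth_default _ sF) addr0 mulr1n.
  by rewrite -mulr_natr /c mulfVK.
move=> x; rewrite !hornerD !hornerZ !hornerXn -/h.
have := FE x; rewrite !hornerE -/h => {}FE.
have := DE x => {}DE.
have -> : c * (x + h) ^+ N.+1 + F.[x + h] - (c * (x - h) ^+ N.+1 + F.[x - h]) =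
  c * ((x + h) ^+ N.+1 - (x - h) ^+ N.+1) + (F.[x + h] - F.[x - h]) by ring.
by rewrite DE FE; ring.
Qed.

(** The sum telescopes through the antiderivative shifted by one half; subtracting the value at 0
    gives a root there, hence the factor [d]. *)
Lemma faulhaber i : exists2 p : {poly rat}, (size p <= i.+1)%N &
  forall d, \sum_(l < d) (l%:R : rat) ^+ i = d%:R * p.[d%:R].
Proof.
have sX : (size ('X^i : {poly rat}) <= i.+1)%N by rewrite size_polyXn.
have [F [sF _ FE]] := central_antiderivative sX.
pose G := F \Po ('X - 2^-1%:P) - (F.[- 2^-1])%:P.
have G0 : root G 0 by rewrite /root /G !hornerE horner_comp !hornerE subrr.
have /factor_theorem[p Gp] := G0; rewrite subr0 in Gp.
exists p.
  have [->|p0] := eqVneq p 0; first by rewrite size_poly0.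
  rewrite -ltnS; have <- : size G = (size p).+1 by rewrite Gp size_mulX.
  apply: leq_trans (size_polyD _ _) _; rewrite geq_max size_polyN.
  apply/andP; split; last by apply: leq_trans (size_polyC_leq1 _) _.
  apply: leq_trans (size_comp_poly_leq _ _) _; rewrite size_XsubC /= muln1.
  by apply: (@leq_trans (i.+1).+1); rewrite // ltnS -subn1 leq_subLR add1n.
move=> d; have <- : G.[d%:R] = d%:R * p.[d%:R] by rewrite Gp hornerMX mulrC.
rewrite /G !hornerE horner_comp !hornerE; elim: d => [|d IH].
  by rewrite big_ord0 add0r subrr.
rewrite big_ord_recr /= IH -hornerXn -FE -(natr1 d).
have -> : d%:R + 1 - 2^-1 = d%:R + 2^-1 :> rat by field.
by ring.
Qed.

(** * Functions of [d] and [k] polynomial of bounded total degree *)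

Section Filtration.

(** The span of the monomials [d^i u^j] with [i + j <= m]. The second coordinate [u] is a parameter
    so that it can be changed from [k] to the centred variable [half_content]; pointwise equations
    replace equality of functions. *)
Inductive filt (u : nat -> nat -> rat) (m : nat) : (nat -> nat -> rat) -> Prop :=
| filt_mon a i j f : (i + j <= m)%N ->
    (forall d k, f d k = a * d%:R ^+ i * u d k ^+ j) -> filt u m f
| filt_add f g h : filt u m f -> filt u m g ->
    (forall d k, h d k = f d k + g d k) -> filt u m h.

Variable u : nat -> nat -> rat.
Implicit Types (f g : nat -> nat -> rat).

Lemma filt_ext m f g : filt u m f -> (forall d k, g d k = f d k) -> filt u m g.
Proof.
case=> [a i j f' lem E|f1 f2 f' h1 h2 E] gE.
  by apply: (filt_mon (a := a) (i := i) (j := j)) => // d k; rewrite gE.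
by apply: filt_add h1 h2 _ => d k; rewrite gE.
Qed.

Lemma filt_le m m' f : (m <= m')%N -> filt u m f -> filt u m' f.
Proof.
move=> le; elim=> [a i j f' lem E|f1 f2 f' _ h1 _ h2 E].
  by apply: filt_mon E; apply: leq_trans lem le.
exact: filt_add h1 h2 E.
Qed.

Lemma filt_zero m : filt u m (fun _ _ => 0).
Proof. by apply: (filt_mon (a := 0) (i := 0) (j := 0)) => // d k; rewrite !mul0r. Qed.

Lemma filt_const m c : filt u m (fun _ _ => c).
Proof. by apply: (filt_mon (a := c) (i := 0) (j := 0)) => // d k; rewrite !expr0 !mulr1. Qed.

Lemma filt_d : filt u 1 (fun d _ => d%:R).
Proof. by apply: (filt_mon (a := 1) (i := 1) (j := 0)) => // d k; rewrite mul1r mulr1. Qed.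

Lemma filt_u : filt u 1 u.
Proof. by apply: (filt_mon (a := 1) (i := 0) (j := 1)) => // d k; rewrite !mul1r. Qed.

Lemma filt_mul m m' f g : filt u m f -> filt u m' g ->
  filt u (m + m') (fun d k => f d k * g d k).
Proof.
move=> Ff Fg; elim: Ff => [a i j f' lem E|f1 f2 f' _ h1 _ h2 E]; last first.
  by apply: filt_add h1 h2 _ => d k; rewrite E mulrDl.
elim: Fg => [a' i' j' g' lem' E'|g1 g2 g' _ h1 _ h2 E']; last first.
  by apply: filt_add h1 h2 _ => d k; rewrite E' mulrDr.
apply: (filt_mon (a := a * a') (i := i + i') (j := j + j')) => [|d k].
  by rewrite addnACA leq_add.
by rewrite E E' !exprD; ring.
Qed.

Lemma filtD m f g : filt u m f -> filt u m g -> filt u m (fun d k => f d k + g d k).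
Proof. by move=> h1 h2; apply: filt_add h1 h2 _. Qed.

Lemma filtZ m c f : filt u m f -> filt u m (fun d k => c * f d k).
Proof. by move=> h; apply: filt_mul (filt_const 0 c) h. Qed.

Lemma filtX m f e : filt u m f -> filt u (m * e) (fun d k => f d k ^+ e).
Proof.
move=> h; elim: e => [|e IH].
  by apply: filt_ext (filt_const _ 1) _ => d k; rewrite expr0.
by rewrite mulnS; apply: filt_ext (filt_mul h IH) _ => d k; rewrite exprS.
Qed.

Lemma filt_sum m N (F : nat -> nat -> nat -> rat) :
  (forall i, (i < N)%N -> filt u m (F i)) -> filt u m (fun d k => \sum_(i < N) F i d k).
Proof.
elim: N => [|N IH] h.
  by apply: filt_ext (filt_zero _) _ => d k; rewrite big_ord0.
apply: filt_ext (filtD (IH _) (h N _)) _ => // [i lti|d k]; first exact: h (ltnW _).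
by rewrite big_ord_recr.
Qed.

End Filtration.

Lemma filt_trans u v m f : filt v 1 u -> filt u m f -> filt v m f.
Proof.
move=> vu; elim=> [a i j f' lem E|f1 f2 f' _ h1 _ h2 E]; last exact: filt_add h1 h2 E.
apply: (filt_le lem).
have hd := filtX i (filt_d v); have hu := filtX j vu; rewrite !mul1n in hd hu.
exact: filt_ext (filt_mul (filtZ a hd) hu) E.
Qed.

Definition legs (d k : nat) : rat := k%:R.
Definition half_content (d k : nat) : rat := (d%:R - 1) / 2 - k%:R.

Lemma filt_legs : filt half_content 1 legs.
Proof.
apply: filt_ext (filtD (filtD (filtZ 2^-1 (filt_d _)) (filtZ (-1) (filt_u _)))
  (filt_const _ _ (- 2^-1))) _ => d k.
by rewrite /legs /half_content; field.
Qed.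

(** Summation raises the degree by one, but by [faulhaber] the gain is a factor [d]. The coordinate
    is [legs] because it stays constant under the summation, whereas [half_content] varies with the
    summation index. *)
Lemma filt_integral m f : filt legs m f ->
  exists2 h, filt legs m h & forall d k, \sum_(l < d) f l k = d%:R * h d k.
Proof.
elim=> [a i j f' lem E|f1 f2 f' _ [h1 F1 E1] _ [h2 F2 E2] E]; last first.
  exists (fun d k => h1 d k + h2 d k); first exact: filtD.
  move=> d k; rewrite mulrDr -E1 -E2 -big_split /=.
  by apply: eq_bigr => l _; rewrite E.
have [p sp pE] := faulhaber i.
exists (fun d k => a * p.[d%:R] * legs d k ^+ j).
  apply: (@filt_le _ (i + j)) => //.
  apply: filt_mul; last by have := filtX j (filt_u legs); rewrite mul1n.
  apply: filtZ; apply: (@filt_ext _ _ (fun d k => \sum_(e < i.+1) p`_e * d%:R ^+ e)).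
    apply: (@filt_sum _ _ _ (fun e d k => p`_e * d%:R ^+ e)) => e lte; apply: (@filt_le _ e) => //.
    by apply: filtZ; have := filtX e (filt_d legs); rewrite mul1n.
  by move=> d k; rewrite (horner_coef_wide _ sp).
move=> d k; rewrite mulrA mulrCA -mulrA -pE mulr_suml mulr_sumr.
by apply: eq_bigr => l _; rewrite E mulrA.
Qed.

Lemma content_coef0 d k : (content_poly d k)`_0 = 1.
Proof.
rewrite -horner_coef0 horner_prod big1 // => l _.
by rewrite hornerD hornerM hornerX mulr0 hornerC addr0.
Qed.

Lemma content_coefS q d k : (content_poly d k)`_q.+1 =
  \sum_(l < d) (l%:R - k%:R) * (content_poly l k)`_q.
Proof.
elim: d => [|d IH]; first by rewrite big_ord0 /content_poly big_ord0 coef1.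
rewrite big_ord_recr /= -IH /content_poly big_ord_recr /=.
rewrite mulrDr mulr1 coefD; congr (_ + _).
have -> : d%:R - k%:R = (d%:R - k%:R : rat)%:P :> {poly rat} by rewrite polyCB !rmorph_nat.
by rewrite mulrCA coefCM coefMX.
Qed.

Lemma content_coef1 d k : (content_poly d k)`_1 = d%:R * half_content d k.
Proof.
rewrite content_coefS; elim: d => [|d IH]; first by rewrite big_ord0 mul0r.
rewrite big_ord_recr /= IH content_coef0 /half_content -natr1; by field.
Qed.

Section ContentLeadingTerm.

Let e (d k : nat) : rat := d%:R - k%:R.
Let x (d k : nat) : rat := d%:R * half_content d k.

Let filt_e : filt legs 1 e.
Proof.
apply: filt_ext (filtD (filt_d _) (filtZ (-1) (filt_u _))) _ => d k.
by rewrite /e /legs mulN1r.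
Qed.

Let filt_x : filt legs 2 x.
Proof.
apply: (@filt_ext _ _ (fun d k => d%:R * (2^-1 * d%:R + (- 2^-1) + (-1) * legs d k))).
  apply: (@filt_mul _ 1 1); first exact: filt_d.
  apply: filtD; last by apply: filtZ; exact: filt_u.
  by apply: filtD; [apply: filtZ; exact: filt_d|exact: filt_const].
by move=> d k; rewrite /x /half_content /legs; field.
Qed.

Let xS d k : x d.+1 k = x d k + e d k.
Proof. by rewrite /x /e /half_content -natr1; field. Qed.

(** The second-order remainder in the increment of [x^(q+1)]: each of its terms contains [e^2], of
    degree 2, in place of two factors [x] of degree 2 each. *)
Let T q d k := (x d k + e d k) ^+ q.+1 - x d k ^+ q.+1 - q.+1%:R * e d k * x d k ^+ q.

Let filt_T q : filt legs (2 * q) (T q).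
Proof.
elim: q => [|q IH].
  by apply: filt_ext (filt_zero _ _) _ => d k; rewrite /T; ring.
apply: (@filt_ext _ _ (fun d k =>
   (q.+1%:R * (e d k ^+ 2 * x d k ^+ q)) + ((x d k + e d k) * T q d k))).
  rewrite mulnS; apply: filtD.
    by apply: filtZ; apply: filt_mul; [exact: (filtX 2 filt_e)|exact: filtX filt_x].
  apply: filt_mul IH; apply: filtD filt_x _; exact: filt_le filt_e.
move=> d k; rewrite /T !exprS -[q.+2%:R]natr1; ring.
Qed.

(* Summing the recurrence for the elementary symmetric functions of contents
   over [d]: only the top-degree term [x^q / q!] survives modulo lower degree,
   and everything else is a multiple of [d]. *)
Lemma content_coef_leading q : exists h, [/\ filt legs (2 * q - 2) h,
  q = 0%N -> forall d k, h d k = 0 &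
  forall d k, (content_poly d k)`_q =
    (d%:R * half_content d k) ^+ q / (q`!)%:R + d%:R * h d k].
Proof.
elim: q => [|q [h [Fh h0 hE]]].
  exists (fun _ _ => 0); split=> // [|d k]; first exact: filt_zero.
  by rewrite content_coef0 expr0 fact0 divr1 mulr0 addr0.
(* [G] is what remains of the summand [e E_q] once the increment of [x^(q+1) / (q+1)!] is taken out;
   that increment telescopes. *)
pose G d k := e d k * (d%:R * h d k) - T q d k / (q.+1`!)%:R.
have FG : filt legs (2 * q) G.
  apply: (@filt_ext _ _ (fun d k => e d k * d%:R * h d k + (- (q.+1`!)%:R^-1) * T q d k)).
    apply: filtD; last exact: filtZ (filt_T q).
    (* For [q = 0] the truncated bound [2 * q - 2] is 0 instead of -2, so the vanishing of [h] is
       needed. *)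
    have [q0|q0] := posnP q.
      by apply: filt_ext (filt_zero _ _) _ => d k; rewrite h0 ?mulr0.
    have -> : (2 * q = 1 + 1 + (2 * q - 2))%N by lia.
    apply: filt_mul Fh; exact: filt_mul filt_e (filt_d _).
  by move=> d k; rewrite /G; ring.
have [h' Fh' hE'] := filt_integral FG.
exists h'; split=> // [|d k]; first by have -> : (2 * q.+1 - 2 = 2 * q)%N by lia.
rewrite -hE' content_coefS; elim: d => [|d IH].
  by rewrite !big_ord0 mul0r expr0n mul0r addr0.
rewrite !big_ord_recr /= IH hE /G /T -/(e d k) -/(x d k) -/(x d.+1 k) xS.
have f1 : (q`!)%:R != 0 :> rat by rewrite pnatr_eq0 -lt0n fact_gt0.
have f2 : q.+1%:R != 0 :> rat by rewrite pnatr_eq0.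
rewrite factS natrM; field; rewrite ?f1 ?f2 ?nat1r //.
Qed.

End ContentLeadingTerm.

(** * Moments of hook characters *)

Section CentralDifference.

Variable R : comNzRingType.
Implicit Types (F : {poly R}) (r : R).

(* With [r = b^2/4] and [N] large, [b * (odd_taylor N r F).[x]] is the central
   difference [F.[x + b/2] - F.[x - b/2]]. *)
Definition odd_taylor N r F : {poly R} := \sum_(l < N) r ^+ l *: F^`N(l.*2.+1).

Lemma size_odd_taylor N r F m : (size F <= m)%N -> (size (odd_taylor N r F) <= m)%N.
Proof.
move=> sF; apply/leq_sizeP => j lej; rewrite coef_sum big1 // => l _.
rewrite coefZ coef_nderivn nth_default ?mul0rn ?mulr0 //.
by apply: leq_trans (leq_trans sF lej) (leq_addl _ _).
Qed.

Lemma odd_taylor0 N F : odd_taylor N.+1 0 F = F^`().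
Proof.
rewrite /odd_taylor big_ord_recl big1 ?addr0 => [|l _]; last by rewrite expr0n scale0r.
by rewrite expr0 scale1r poly.nderivn1.
Qed.

Lemma sum_ord_double N (f : nat -> R) :
  \sum_(i < N.*2) f i = \sum_(l < N) (f l.*2 + f l.*2.+1).
Proof.
elim: N => [|N IH]; first by rewrite !big_ord0.
by rewrite doubleS !big_ord_recr /= IH addrA.
Qed.

End CentralDifference.

Lemma odd_taylor_map (R S : comNzRingType) (phi : {rmorphism R -> S}) N r (F : {poly R}) :
  map_poly phi (odd_taylor N r F) = odd_taylor N (phi r) (map_poly phi F).
Proof.
rewrite rmorph_sum; apply: eq_bigr => l _.
by rewrite nderivn_map -rmorphXn; exact: map_polyZ.
Qed.

(** In the Taylor expansion at [x] the even orders cancel and the odd ones double: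
    [2 (b/2)^(2l+1) = b (b^2/4)^l]. *)
Lemma central_differenceE N (F : {poly rat}) (b x : rat) : (size F <= N.*2)%N ->
  F.[x + b / 2] - F.[x - b / 2] = b * (odd_taylor N (b ^+ 2 / 4) F).[x].
Proof.
move=> sF; rewrite !(nderiv_taylor_wide _ sF); try exact: mulrC.
rewrite -sumrB.
rewrite (sum_ord_double N (fun i => F^`N(i).[x] * (b / 2) ^+ i - F^`N(i).[x] * (- (b / 2)) ^+ i)).
rewrite horner_sum mulr_sumr; apply: eq_bigr => l _.
rewrite hornerZ ![_ ^+ _.*2.+1]exprS -!mul2n !exprM sqrrN.
have -> : (b / 2) ^+ 2 = b ^+ 2 / 4 by field.
by set y := (_ ^+ l); field.
Qed.

Section MomentFunctional.

Definition poly_pair (p : {poly rat}) (G : nat -> rat) := \sum_(m < size p) p`_m * G m.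

Lemma poly_pair_wide N (p : {poly rat}) G : (size p <= N)%N -> poly_pair p G = \sum_(m < N) p`_m * G m.
Proof.
move=> le; rewrite /poly_pair (big_ord_widen N (fun m => p`_m * G m)) // big_mkcond.
by apply: eq_bigr => m _; case: ltnP => // h; rewrite nth_default ?mul0r.
Qed.

Lemma size_one_subXn b (p : {poly rat}) :
  (size ((1 - 'X^b) * p)%R <= b + size p)%N.
Proof.
apply: leq_trans (size_polyMleq _ _) _.
have : (size (1 - 'X^b : {poly rat})%R <= b.+1)%N.
  by apply: leq_trans (size_polyD _ _) _; rewrite size_polyN size_polyXn size_poly1 geq_max /=.
by move=> le1; rewrite -subn1 leq_subLR add1n -addSn leq_add2r.
Qed.

Lemma poly_pair_mul b p G :
  poly_pair ((1 - 'X^b) * p) G = poly_pair p (fun m => G m - G (b + m)%N).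
Proof.
rewrite (poly_pair_wide _ (size_one_subXn b p)).
have lep : (size p <= b + size p)%N by exact: leq_addl.
rewrite [RHS]/poly_pair; under [RHS]eq_bigr do rewrite mulrBr.
rewrite sumrB -/(poly_pair p G) (poly_pair_wide G lep) mulrBl mul1r.
under eq_bigr do rewrite coefB mulrBl.
rewrite sumrB; congr (_ - _).
rewrite big_split_ord /= big1 ?add0r => [|m _]; last by rewrite coefXnM ltn_ord mul0r.
by apply: eq_bigr => m _; rewrite coefXnM ltnNge leq_addr /= addKn.
Qed.

Definition cdiff (b : rat) (F : rat -> rat) x := F (x + b / 2) - F (x - b / 2).

(** Under [poly_pair], multiplication by [1 - 'X^c] is dual to a difference with step [c]; the
    offset [sumn b / 2] centres all of these at [x]. *)
Lemma foldr_cdiff (b : seq nat) (F : rat -> rat) x :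
  foldr (fun c => cdiff c%:R) F b x =
  poly_pair (\prod_(c <- b) (1 - 'X^c)) (fun m => F (x + (sumn b)%:R / 2 - m%:R)).
Proof.
elim: b x => [|c b IH] x /=.
  rewrite big_nil /poly_pair size_poly1 big_ord1 coef1 mul1r.
  by congr F; rewrite /=; field.
rewrite big_cons poly_pair_mul /cdiff !IH /poly_pair -sumrB; apply: eq_bigr => m _.
by rewrite -mulrBr; congr (_ * (F _ - F _)); rewrite !natrD; field.
Qed.

Lemma foldr_odd_taylor N (b : seq rat) (F : {poly rat}) x : (size F <= N.*2)%N ->
  foldr cdiff (fun y => F.[y]) b x =
  (\prod_(c <- b) c) * (foldr (fun c => odd_taylor N (c ^+ 2 / 4)) F b).[x].
Proof.
move=> sF.
have sfold (b' : seq rat) : (size (foldr (fun c => odd_taylor N (c ^+ 2 / 4)) F b') <= N.*2)%N.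
  by elim: b' => //= c b' IH; exact: size_odd_taylor.
elim: b x => [|c b IH] x /=; first by rewrite big_nil mul1r.
rewrite big_cons /cdiff !IH -mulrBr (central_differenceE _ _ (sfold b)); ring.
Qed.

(** The factor [1 - 'X] in front of [Phi] is dual to a difference with step 1, which turns [F] back
    into [p]. At [x = 0] its midpoint is [(d - 1)/2 - k], that is, [half_content d k]. *)
Lemma hook_moment (b : seq nat) (Phi F p : {poly rat}) N :
  let d := sumn b in
  (1 - 'X) * Phi = \prod_(c <- b) (1 - 'X^c) -> (size F <= N.*2)%N ->
  (forall x, F.[x + 2^-1] - F.[x - 2^-1] = p.[x]) ->
  \sum_(k < d) Phi`_k * p.[half_content d k] =
  (\prod_(c <- b) c%:R) *
    (foldr (fun c => odd_taylor N (c%:R ^+ 2 / 4)) F b).[0].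
Proof.
move=> d hPhi sF FE.
have sPhi : (size Phi <= d)%N.
  have [->|P0] := eqVneq Phi 0; first by rewrite size_poly0.
  have : (size (\prod_(c <- b) (1 - 'X^c : {poly rat}))%R <= d.+1)%N.
    rewrite /d; elim: (b) => [|c b' IH]; first by rewrite big_nil size_poly1.
    rewrite big_cons /= -addnS; apply: leq_trans (size_one_subXn _ _) _.
    by rewrite leq_add2l.
  rewrite -hPhi size_mul ?one_subX_neq0 //.
  by rewrite -opprB size_polyN size_XsubC.
have := foldr_odd_taylor [seq c%:R | c <- b] 0 sF.
rewrite !foldr_map big_map => <-; rewrite foldr_cdiff -hPhi.
rewrite (poly_pair_mul 1) (poly_pair_wide _ sPhi); apply: eq_bigr => k _.
by rewrite -FE -/d natrD; congr (_ * (F.[_] - F.[_])); rewrite /half_content; field.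
Qed.

End MomentFunctional.

(** * The moments as polynomials in the parts *)

Section MomentPolynomial.

Variable n : nat.
Implicit Types (P Q : {mpoly rat[n]}) (F : {poly {mpoly rat[n]}}).

Lemma msizeM_bound P Q i j : (msize P <= i.+1)%N -> (msize Q <= j)%N ->
  (msize (P * Q) <= i + j)%N.
Proof.
move=> hP hQ; have [->|P0] := eqVneq P 0; first by rewrite mul0r msize0.
have [->|Q0] := eqVneq Q 0; first by rewrite mulr0 msize0.
by rewrite msizeM // -subn1 leq_subLR add1n -addSn leq_add.
Qed.

Lemma msizeX_bound P e i : (msize P <= i.+1)%N -> (msize (P ^+ e) <= (i * e).+1)%N.
Proof.
move=> hP; elim: e => [|e IH]; first by rewrite expr0 msize1.
by rewrite exprS mulnS -addnS; apply: msizeM_bound.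
Qed.

Lemma msizeMn P k i : (msize P <= i)%N -> (msize (P *+ k) <= i)%N.
Proof. by move=> h; rewrite -scaler_nat; apply: leq_trans (msizeZ_le _ _) h. Qed.

Lemma msize_sum_bound N (G : 'I_N -> {mpoly rat[n]}) i :
  (forall l, msize (G l) <= i)%N -> (msize (\sum_l G l) <= i)%N.
Proof.
move=> h; apply: leq_trans (mmeasure_sum _ _ _ _) _.
by apply/bigmax_leqP => l _; exact: h.
Qed.

(** The total degree in the parts and the variable of [F] together is below [m]; truncated
    subtraction forces the coefficients from [m] on to vanish. *)
Definition weight_le m F := forall j, (msize F`_j <= m - j)%N.

(** The term [r^l] adds degree [2l] while the derivative of order [2l + 1] removes one more, so the
    weight drops by 1. *)
Lemma weight_odd_taylor N m F (r : {mpoly rat[n]}) : (msize r <= 3)%N ->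
  weight_le m F -> weight_le m.-1 (odd_taylor N r F).
Proof.
move=> hr hF j; rewrite coef_sum; apply: msize_sum_bound => l.
rewrite coefZ coef_nderivn.
have := hF (l.*2.+1 + j)%N; set z := F`_ _ => hz.
have [z0|/negPf z0] := eqVneq z 0; first by rewrite z0 mul0rn mulr0 msize0.
have : (0 < msize z)%N by rewrite lt0n mmeasure_poly_eq0 z0.
move=> pz; have lez : (l.*2.+1 + j <= m)%N by lia.
have -> : (m.-1 - j = 2 * l + (m - (l.*2.+1 + j)))%N by lia.
apply: msizeM_bound; first exact: msizeX_bound.
exact: msizeMn.
Qed.

Definition qsq (i : 'I_n) : {mpoly rat[n]} := (4^-1)%:MP * 'X_i ^+ 2.

Definition moment_poly N (f : {poly rat}) : {mpoly rat[n]} :=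
  (foldr (fun i => odd_taylor N (qsq i)) (map_poly (@mpolyC n rat) f) (enum 'I_n)).[0].

Lemma msize_qsq i : (msize (qsq i) <= 3)%N.
Proof.
rewrite /qsq mul_mpolyC; apply: leq_trans (msizeZ_le _ _) _.
by apply: (msizeX_bound 2 (i := 1)); rewrite msizeX mdeg1.
Qed.

Lemma msize_moment_poly N f : (msize (moment_poly N f) <= size f - n)%N.
Proof.
have base : weight_le (size f) (map_poly (@mpolyC n rat) f).
  move=> j; rewrite coef_map /=; have [ltj|lej] := ltnP j (size f).
    by rewrite mmeasureC (leq_trans (leq_b1 _)) // subn_gt0.
  by rewrite nth_default // msize0.
suff h (r : seq 'I_n) : weight_le (size f - size r)
    (foldr (fun i => odd_taylor N (qsq i)) (map_poly (@mpolyC n rat) f) r).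
  by have := h (enum 'I_n) 0%N; rewrite size_enum_ord subn0 /moment_poly horner_coef0.
elim: r => [|i r IH] /=; first by rewrite subn0.
by rewrite subnS; apply: weight_odd_taylor IH; exact: msize_qsq.
Qed.

(** Stated for any ring morphism, to serve both evaluation at a point and restriction to a line. *)
Lemma map_moment_poly (S : comNzRingType) (phi : {rmorphism {mpoly rat[n]} -> S}) N f :
  phi (moment_poly N f) =
  (foldr (fun i => odd_taylor N (phi (qsq i)))
     (map_poly (fun c => phi c%:MP) f) (enum 'I_n)).[0].
Proof.
rewrite /moment_poly -(rmorph0 phi) -horner_map; congr (_.[_]).
elim: (enum 'I_n) => [|i r IH] /=.
  by apply/polyP=> j; rewrite !coef_map_id0 ?rmorph0 ?raddf0 ?mpolyC0 //.
by rewrite odd_taylor_map IH.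
Qed.

Lemma meval_moment_poly N f (v : 'I_n -> rat) :
  (moment_poly N f).@[v] =
  (foldr (fun i => odd_taylor N (v i ^+ 2 / 4)) f (enum 'I_n)).[0].
Proof.
have := map_moment_poly (meval v) N f; rewrite /= => ->; congr (_.[_]).
elim: (enum 'I_n) => [|i r IH] /=.
  by apply/polyP=> j; rewrite coef_map_id0 ?mevalC.
rewrite IH; congr odd_taylor.
by rewrite /qsq mevalM mevalC rmorphXn /= mevalXU mulrC.
Qed.

End MomentPolynomial.

(** * Exact degree by restriction to a coordinate axis *)

Section MomentDegree.

Variable n' : nat.
Let n := n'.+1.

Let h (i : 'I_n) : {poly rat} := if i == ord0 then 'X else 0.
Let psi : {mpoly rat[n]} -> {poly rat} := mmap polyC h.

Lemma size_mmap_line (P : {mpoly rat[n]}) : (size (psi P) <= msize P)%N.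
Proof.
rewrite /psi /mmap; apply: leq_trans (size_sum _ _ _) _.
rewrite msizeE; apply/bigmax_leqP_seq => m mP _.
apply: leq_trans (leq_bigmax_seq _ mP _) => //.
rewrite mul_polyC; apply: leq_trans (size_scale_leq _ _) _.
rewrite mdegE /mmap1.
apply: (big_ind2 (fun (p : {poly rat}) k => size p <= k.+1)%N).
- by rewrite size_poly1.
- by move=> p1 k1 p2 k2 h1 h2; apply: leq_trans (size_polyMleq _ _) _; lia.
move=> i _; apply: leq_trans (size_poly_exp_leq _ _) _; rewrite /h.
by case: ifP => _; rewrite ?size_polyX ?size_poly0 /= ?mul1n ?mul0n.
Qed.

(** On the first axis the other [n'] operators have [r = 0] and become derivatives. The coefficient
    of ['X^(2g)] then comes from the term [l = g] alone: it is [4^-g] times the leading coefficient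
    of [f] times a positive falling factorial. *)
Lemma msize_moment_poly_top N g (f : {poly rat}) : (g < N)%N -> size f = (2 * g + n).+1 ->
  msize (moment_poly n N f) = (2 * g).+1.
Proof.
move=> ltg sf; apply/eqP; rewrite eqn_leq; apply/andP; split.
  by apply: leq_trans (msize_moment_poly _ _ _) _; rewrite sf; lia.
apply: leq_trans (size_mmap_line _).
suff nz : (psi (moment_poly n N f))`_(2 * g) != 0.
  by rewrite ltnNge; apply: contraNN nz => le; rewrite nth_default.
rewrite /psi (map_moment_poly (mmap polyC h : {rmorphism _ -> _})) /=.
case: N ltg => // N ltg.
have q0 : mmap polyC h (qsq ord0) = (4^-1)%:P * 'X^2.
  by rewrite /qsq rmorphM rmorphXn /= mmapC mmapX mmap1U.
have qS i : mmap polyC h (qsq (lift ord0 i)) = 0.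
  by rewrite /qsq rmorphM rmorphXn /= mmapX mmap1U expr0n mulr0.
have -> : map_poly (fun c => mmap polyC h c%:MP) f = map_poly polyC f.
  by apply/polyP=> j; rewrite !coef_map_id0 ?mmapC ?mpolyC0 ?mmap0.
rewrite enum_ordSl /= foldr_map q0.
have -> : foldr (fun i => odd_taylor N.+1 (mmap polyC h (qsq (lift ord0 i))))
    (map_poly polyC f) (enum 'I_n') = map_poly polyC f^`(n').
  rewrite -derivn_map; transitivity ((map_poly polyC f)^`(size (enum 'I_n'))).
    by elim: (enum 'I_n') => [|i r IH] //=; rewrite IH qS odd_taylor0.
  by rewrite size_enum_ord.
rewrite horner_sum coef_sum (bigD1 (Ordinal ltg)) //= big1 ?addr0.
  rewrite hornerZ nderivn_map horner_coef0 coef_map /= coefMC exprMn -rmorphXn /= coefCM.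
  rewrite -exprM coefXn eqxx mulr1 coef_nderivn coef_derivn addn0 binn mulr1n.
  have -> : (n' + g.*2.+1 = (size f).-1)%N by rewrite sf /n -mul2n /=; lia.
  rewrite -lead_coefE mulf_neq0 ?expf_neq0 ?invr_eq0 ?pnatr_eq0 //.
  rewrite -mulr_natr mulf_neq0 ?lead_coef_eq0 -?size_poly_eq0 ?sf // pnatr_eq0 -lt0n ffact_gt0.
  by rewrite /n; lia.
move=> l nlg.
rewrite hornerZ nderivn_map horner_coef0 coef_map /= coefMC exprMn -rmorphXn /= coefCM.
rewrite -exprM coefXn eqn_mul2l /=.
case: eqP => [gl|_]; last by rewrite mulr0 mul0r.
by move: nlg; rewrite -val_eqE /= gl eqxx.
Qed.

End MomentDegree.

(** * Powers of the size of the partition *)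

Section PartSum.

Variable n : nat.
Implicit Types (P Q : {mpoly rat[n]}).

Definition part_sum : {mpoly rat[n]} := \sum_(i < n) 'X_i.

Lemma part_sum_homog e : part_sum ^+ e \is e.-homog.
Proof.
rewrite -[e in e.-homog]mul1n; apply: dhomogMn; apply: rpred_sum => i _.
by rewrite dhomogX; apply/eqP; exact: mdeg1.
Qed.

Lemma meval_part_sum (b : 'I_n -> nat) :
  part_sum.@[fun i => (b i)%:R] = (\sum_(i < n) b i)%N%:R.
Proof. by rewrite rmorph_sum natr_sum; apply: eq_bigr => i _ /=; rewrite mevalXU. Qed.

Lemma part_sum_neq0 e : (0 < n)%N -> part_sum ^+ e != 0.
Proof.
move=> n0; apply: expf_neq0; apply/eqP=> E.
have := meval_part_sum (fun=> 1%N); rewrite E meval0 sum1_card card_ord => /esym/eqP.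
by rewrite pnatr_eq0 -leqn0 leqNgt n0.
Qed.

Lemma msize_part_sum e : (msize (part_sum ^+ e) <= e.+1)%N.
Proof.
rewrite msizeE; apply/bigmax_leqP_seq => m mP _.
by have /dhomogP -> := part_sum_homog e.
Qed.

Lemma msize_part_sum_eq e : (0 < n)%N -> msize (part_sum ^+ e) = e.+1.
Proof.
move=> n0; have p0 := part_sum_neq0 e n0; rewrite -mlead_deg //.
by have /dhomogP -> := part_sum_homog e; rewrite ?mlead_supp.
Qed.

(** Source of the lower bound on degrees: the factor is homogeneous of degree [e]. *)
Lemma mdeg_part_sum_mul e Q m : m \in msupp (part_sum ^+ e * Q) -> (e <= mdeg m)%N.
Proof.
move/msuppM_le/allpairsP => [[m1 m2] [/= h1 h2 ->]]; rewrite mdegD.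
by have /dhomogP -> := part_sum_homog e; rewrite ?leq_addr.
Qed.

Lemma msizeD_lt P Q : (msize Q < msize P)%N -> msize (P + Q) = msize P.
Proof.
move=> lt; apply/eqP; rewrite eqn_leq; apply/andP; split.
  apply: leq_trans (mmeasureD_le _ _ _) _.
  by rewrite geq_max leqnn ltnW.
rewrite leqNgt; apply/negP=> lt2.
have := mmeasureD_le mdeg (P + Q) (- Q); rewrite addrK mmeasureN leqNgt.
by rewrite gtn_max lt2 lt.
Qed.

End PartSum.

(** * Hook averages represented by polynomials *)

Section Moments.

Variable n : nat.

(* [Phi] is the generating polynomial of the values of the hook characters at
   a permutation whose cycle lengths are the [b i]. *)
Definition hook_series (b : 'I_n -> nat) (Phi : {poly rat}) :=
  (1 - 'X) * Phi = \prod_(c <- [seq b i | i <- enum 'I_n]) (1 - 'X^c).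

Definition hook_mean (b : 'I_n -> nat) (Phi : {poly rat}) (f : nat -> nat -> rat) :=
  \sum_(k < \sum_(i < n) b i) Phi`_k * f (\sum_(i < n) b i)%N k.

Definition represents (f : nat -> nat -> rat) (Q : {mpoly rat[n]}) :=
  forall b Phi, hook_series b Phi ->
    hook_mean b Phi f = (\prod_(i < n) (b i)%:R) * Q.@[fun i => (b i)%:R].

Lemma sumn_enum (b : 'I_n -> nat) : sumn [seq b i | i <- enum 'I_n] = (\sum_(i < n) b i)%N.
Proof. by rewrite sumnE big_map big_enum. Qed.

(** The antiderivative of ['X^s] has size exactly [s + 2] and each of the [n] operators removes one.
    When [s + 1 - n] is the even number [2g], the bound is attained. *)
Lemma moment_exists s : exists M : {mpoly rat[n]}, [/\
  represents (fun d k => half_content d k ^+ s) M, (msize M <= s.+2 - n)%N &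
  forall g, (0 < n)%N -> (s.+1 = 2 * g + n)%N -> msize M = (2 * g).+1].
Proof.
have sX : (size ('X^s : {poly rat}) <= s.+1)%N by rewrite size_polyXn.
have [F [sF lF FE]] := central_antiderivative sX.
have {}lF : F`_s.+1 != 0.
  apply/eqP=> F0; move: lF; rewrite F0 mul0rn /= coefXn eqxx => /esym/eqP.
  by rewrite oner_eq0.
have {}sF : size F = s.+2.
  by apply/eqP; rewrite eqn_leq sF ltnNge; apply: contraNN lF => le; rewrite nth_default.
exists (moment_poly n s.+2 F); split.
- move=> b Phi hb.
  have sF2 : (size F <= s.+2.*2)%N by rewrite sF -addnn leq_addr.
  have := hook_moment hb sF2 FE; rewrite /= sumn_enum /hook_mean => E.
  move: E; rewrite big_map big_enum /= meval_moment_poly foldr_map => <-.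
  by apply: eq_bigr => k _; rewrite hornerXn.
- by apply: leq_trans (msize_moment_poly _ _ _) _; rewrite sF.
case: (n) => // n' g _ sE; apply: msize_moment_poly_top; last by rewrite sF sE.
lia.
Qed.

(** On a monomial, [d] becomes [part_sum] and leaves the average, and the power of [half_content]
    joins the exponent [t]. *)
Lemma filt_represents t m f : filt half_content m f -> exists2 Q : {mpoly rat[n]},
  represents (fun d k => half_content d k ^+ t * f d k) Q & (msize Q <= m + t + 2 - n)%N.
Proof.
elim=> [a i j f' lem E|f1 f2 f' _ [Q1 R1 s1] _ [Q2 R2 s2] E]; last first.
  exists (Q1 + Q2).
    move=> b Phi hb; rewrite mevalD mulrDr -(R1 _ _ hb) -(R2 _ _ hb) -big_split /=.
    by apply: eq_bigr => k _; rewrite E; ring.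
  by apply: leq_trans (mmeasureD_le _ _ _) _; rewrite geq_max s1.
have [M [RM sM _]] := moment_exists (t + j).
exists (a *: (part_sum n ^+ i * M)).
  move=> b Phi hb; rewrite mevalZ mevalM rmorphXn /= meval_part_sum.
  rewrite mulrCA [X in a * X]mulrCA -(RM _ _ hb) /hook_mean !mulr_sumr.
  by apply: eq_bigr => k _; rewrite E exprD; ring.
apply: leq_trans (msizeZ_le _ _) _.
(* A nonzero [M] forces [n < t + j + 2], so the subtraction in the bound is not truncated. *)
have [->|M0] := eqVneq M 0; first by rewrite mulr0 msize0.
have M1 : (0 < msize M)%N by rewrite lt0n mmeasure_poly_eq0.
have lej : (n < (t + j).+2)%N by rewrite -subn_gt0 (leq_trans M1).
apply: leq_trans (msizeM_bound (msize_part_sum n i) sM) _; lia.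
Qed.

Lemma hook_series_exists (b : 'I_n -> nat) : (0 < n)%N -> exists Phi, hook_series b Phi.
Proof.
rewrite /hook_series => n0.
case E : [seq b i | i <- enum 'I_n] => [|c r].
  by move/(congr1 size): E n0; rewrite size_map size_enum_ord => /= ->.
exists ((\sum_(i < c) 'X^i) * \prod_(c <- r) (1 - 'X^c)).
by rewrite big_cons mulrA -[1 - 'X^c]opprB subrX1 -mulNr opprB.
Qed.

End Moments.

(** The condition [q < d] is [m > 0]. Lowest degrees are compared in the integers to avoid truncated
    subtraction, and [msize] is the degree plus one. *)
Theorem theorem3p6 (q n g : nat) (hn : (0 < n)%N) (hgqn : (q + 3 <= 2 * g + n)%N) :
  let t := (2 * g + n - 1 - q)%N in
  exists P : {mpoly rat[n]},
    (forall b : 'I_n -> nat, (forall i, 0 < b i)%N ->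
       let d := (\sum_(i < n) b i)%N in
       (q < d)%N ->
       P.@[fun i => ((b i)%:R)%R] =
         (hurwitz g (d - q) [seq b i | i <- enum 'I_n] / ((t`!)%:R * d%:R))%R)
    /\ (forall mo, mo \in msupp P ->
          ((2 * g + n)%:Z - 2 - (q == 0%N)%:Z - q%:Z <= (mdeg mo)%:Z)%R)
    /\ msize P = (4 * g + n - 3).+1.
Proof.
(* The hypothesis gives [t >= 2], so two factors [d] can be divided out. *)
move=> t; have tE : t = (t - 2).+2 by rewrite /t; lia.
have [h [Fh h0 hE]] := content_coef_leading q.
(* [Q] carries the correction term [d h], of degree below the top one. The case [q = 0] is separate
   because the truncated bound on [h] would be too weak there. *)
have [Q [RQ sQ]] : exists Q : {mpoly rat[n]},
    represents (fun d k => half_content d k ^+ t * h d k) Q /\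
    (msize (part_sum n ^+ (t - 1) * Q) <= 4 * g + n - 3)%N.
  have [q0|q0] := posnP q.
    exists 0; split; last by rewrite mulr0 msize0.
    move=> b Phi _; rewrite meval0 mulr0 /hook_mean big1 // => k _.
    by rewrite h0 // !mulr0.
  have [Q RQ sQ] := filt_represents n t (filt_trans filt_legs Fh).
  exists Q; split=> //; apply: leq_trans (msizeM_bound (msize_part_sum n _) sQ) _.
  by rewrite /t; lia.
(* Here [t + q + 1 = 2g + n], the case in which the degree of the moment is known exactly. *)
have [M [RM _ sM]] := moment_exists n (t + q).
have {}sM : msize M = (2 * g).+1 by apply: sM => //; rewrite /t; lia.
have M0 : M != 0 by rewrite -(mmeasure_poly_eq0 mdeg) sM.
have fn0 m : (m`!)%:R != 0 :> rat by rewrite pnatr_eq0 -lt0n fact_gt0.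
(* The leading term brings [d^(t+q)] and the correction [d^(t+1)]; one factor [d] is lost to the
   denominator of the hook formula and one to the scaling. *)
pose P1 := (q`!)%:R^-1 *: (part_sum n ^+ (t - 2 + q) * M).
pose P2 := part_sum n ^+ (t - 1) * Q.
have sP1 : msize P1 = (4 * g + n - 3).+1.
  rewrite msizeZ ?invr_eq0 // msizeM ?part_sum_neq0 // msize_part_sum_eq // sM.
  by rewrite /t; lia.
exists ((t`!)%:R^-1 *: (P1 + P2)); split; last split.
- move=> b bpos d ltqd.
  have [Phi hPhi] := hook_series_exists b hn.
  have bs_pos : all (leq 1) [seq b i | i <- enum 'I_n].
    by apply/allP => _ /mapP[i _ ->].
  have d0 : (0 < d)%N by apply: leq_trans ltqd.
  have dn0 : d%:R != 0 :> rat by rewrite pnatr_eq0 -lt0n.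
  have := hurwitz_hook_sum g (q := q) (b := [seq b i | i <- enum 'I_n]).
  rewrite /= sumn_enum size_map size_enum_ord -/d -/t => /(_ Phi d0 (ltnW ltqd) bs_pos hPhi) ->.
  rewrite big_map big_enum /=.
  pose p : rat := \prod_(i < n) (b i)%:R; rewrite -/p.
  have pn0 : p != 0 by apply/prodf_neq0 => i _; rewrite pnatr_eq0 -lt0n.
  rewrite mevalZ mevalD mevalZ !mevalM !rmorphXn /= meval_part_sum -/d.
  have -> : \sum_(k < d) (content_poly d k)`_1 ^+ t * (content_poly d k)`_q * Phi`_k =
      d%:R ^+ (t + q) / (q`!)%:R * (p * M.@[fun i => (b i)%:R]) +
      d%:R ^+ t.+1 * (p * Q.@[fun i => (b i)%:R]).
    rewrite -(RM _ _ hPhi) -(RQ _ _ hPhi) /hook_mean -/d !mulr_sumr -big_split /=.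
    apply: eq_bigr => k _; rewrite content_coef1 hE !exprMn !exprD exprS.
    by field; rewrite fn0.
  have -> : d%:R ^+ (t + q) = d%:R ^+ (t - 2 + q) * (d%:R * d%:R) :> rat.
    by rewrite -expr2 -exprD; congr (_ ^+ _); lia.
  have -> : d%:R ^+ t.+1 = d%:R ^+ (t - 1) * (d%:R * d%:R) :> rat.
    by rewrite -expr2 -exprD; congr (_ ^+ _); lia.
  by field; rewrite ?fn0 ?dn0 ?pn0.
(* The powers of [part_sum] give lowest degrees at least [2g + n - 3] for [P1] and [2g + n - 2 - q]
   for [P2]; the first is the smaller one only for [q = 0], whence the Kronecker delta. *)
- move=> mo /msuppZ_le /msuppD_le; rewrite mem_cat => /orP[/msuppZ_le|] /mdeg_part_sum_mul.
    by rewrite /t; case: eqP; lia.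
  by rewrite /t; case: eqP; lia.
rewrite msizeZ ?invr_eq0 // msizeD_lt sP1 //.
Qed.
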